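(* Let $4-Q<\alpha<Q$. Then for every $r>0$ and every $\phi\in C_0^\infty(B_r)$, $$\int_{B_r}\frac{\rho^{\alpha}}{|\nabla_\gamma\rho|^2}|\Delta_\gamma\phi|^2\,dz\ \ge\ \frac{(Q+\alpha-4)^2(Q-\alpha)^2}{16}\int_{B_r}\rho^{\alpha-4}|\nabla_\gamma\rho|^2\phi^2\,dz+\frac{(Q+\alpha-4)(Q-\alpha)}{8}\int_{B_r}\rho^{\alpha-4}|\nabla_\gamma\rho|^2\frac{\phi^2}{\big(\ln\frac{r}{\rho}\big)^2}\,dz .$$
   Context: Points of $\mathbb{R}^n$ are written $z=(x,y)$ with $x\in\mathbb{R}^m$, $y\in\mathbb{R}^k$, $m,k\ge1$, $n=m+k$, and $\gamma>0$. The Baouendi–Grushin gradient is $\nabla_\gamma=(\partial_{x_1},\dots,\partial_{x_m},|x|^\gamma\partial_{y_1},\dots,|x|^\gamma\partial_{y_k})$, and the Baouendi–Grushin operator is $\Delta_\gamma=\nabla_\gamma\cdot\nabla_\gamma=\Delta_x+|x|^{2\gamma}\Delta_y$. The homogeneous dimension is $Q=m+(1+\gamma)k$. The gauge is $\rho(z)=\big(|x|^{2(1+\gamma)}+(1+\gamma)^2|y|^2\big)^{\frac{1}{2(1+\gamma)}}$; one has $|\nabla_\gamma\rho|=|x|^\gamma/\rho^\gamma$. For $r>0$, $B_r=\{z\in\mathbb{R}^n:\rho(z)<r\}$. The integral on the left-hand side is allowed to be $+\infty$. *)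

(* Defs.v *)
From HB Require Import structures.
From mathcomp Require Import all_boot all_order all_algebra.
From mathcomp Require Import all_classical all_reals all_analysis.
Unset Strict Implicit. Unset Printing Implicit Defensive.
Import Order.TTheory GRing.Theory Num.Theory.
Import numFieldNormedType.Exports.
Local Open Scope classical_set_scope.
Local Open Scope ring_scope.

Section BG.
Variable R : realType.

(* Euclidean norm on R^p (the library norm on 'rV is the sup norm) *)
Definition enorm (p : nat) (v : 'rV[R]_p) : R := Num.sqrt (\sum_(i < p) v 0 i ^+ 2).

Definition partial (p : nat) (i : 'I_p) (f : 'rV[R]_p -> R) : 'rV[R]_p -> R :=
  fun z => 'D_(delta_mx 0 i) f z.

Definition iter_partial (p : nat) (s : seq 'I_p) (f : 'rV[R]_p -> R) : 'rV[R]_p -> R :=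
  foldr (fun i g => partial p i g) f s.

Definition smooth (p : nat) (f : 'rV[R]_p -> R) : Prop :=
  forall s : seq 'I_p, continuous (iter_partial p s f) /\
    forall (i : 'I_p) (z : 'rV[R]_p), derivable (iter_partial p s f) z (delta_mx 0 i).

Definition supp (p : nat) (f : 'rV[R]_p -> R) : set 'rV[R]_p :=
  closure [set z | f z != 0].

Definition Cc_infty (p : nat) (U : set 'rV[R]_p) (f : 'rV[R]_p -> R) : Prop :=
  smooth p f /\ compact (supp p f) /\ supp p f `<=` U.

(* Points z = (x,y) of R^(m+k): x = lsubmx z, y = rsubmx z *)
Definition gauge (m k : nat) (g : R) (z : 'rV[R]_(m + k)) : R :=
  powR (powR (enorm m (lsubmx z)) (2 * (1 + g)) + (1 + g) ^+ 2 * enorm k (rsubmx z) ^+ 2)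
       (1 / (2 * (1 + g))).

Definition ball_BG (m k : nat) (g r : R) : set 'rV[R]_(m + k) :=
  [set z | gauge m k g z < r].

Definition grad_BG (m k : nat) (g : R) (f : 'rV[R]_(m + k) -> R) (z : 'rV[R]_(m + k))
  : 'rV[R]_(m + k) :=
  \row_(i < m + k)
     (if (i < m)%N then partial (m + k) i f z else powR (enorm m (lsubmx z)) g * partial (m + k) i f z).

Definition Delta_BG (m k : nat) (g : R) (f : 'rV[R]_(m + k) -> R) (z : 'rV[R]_(m + k)) : R :=
  \sum_(i < m + k | (i < m)%N) partial (m + k) i (partial (m + k) i f) z
  + powR (enorm m (lsubmx z)) (2 * g) *
    \sum_(i < m + k | (m <= i)%N) partial (m + k) i (partial (m + k) i f) z.

Definition homdim (m k : nat) (g : R) : R := m%:R + (1 + g) * k%:R.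

(* Lebesgue integral over R^p of a nonnegative function, as the iterated
   integral w.r.t. the Lebesgue measure on R (equal to the integral w.r.t.
   p-dimensional Lebesgue measure by Tonelli). *)
Fixpoint iint (p : nat) : ('rV[R]_p -> \bar R) -> \bar R :=
  match p return ('rV[R]_p -> \bar R) -> \bar R with
  | 0 => fun f => f 0
  | p'.+1 => fun f =>
      (\int[@lebesgue_measure R]_(t in [set: R])
          iint p' (fun v : 'rV[R]_p' => f (row_mx (const_mx t : 'rV[R]_1) v)))%E
  end.

End BG.
Arguments enorm {R p}.
Arguments partial {R p}.
Arguments iter_partial {R p}.
Arguments smooth {R p}.
Arguments supp {R p}.
Arguments Cc_infty {R p}.
Arguments gauge {R}.
Arguments ball_BG {R}.
Arguments grad_BG {R}.
Arguments Delta_BG {R}.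
Arguments homdim {R}.
Arguments iint {R p}.

(* Main.v *)
(** Write rho for the gauge, grad and Delta for the Grushin gradient and operator,
    N = Q + alpha - 4 and c0 = N (Q - alpha) / 4.  For a radial weight W(rho) >= 0,
    completing the square gives
      rho^alpha |Delta phi|^2 / |grad rho|^2
        >= - 2 W phi Delta phi - W^2 rho^(-alpha) |grad rho|^2 phi^2,
    and, for every radial function h, W |grad phi - phi h grad rho|^2 >= 0 bounds
    the right-hand side from below by
      2 div (- W phi grad phi + 1/2 (2 W h + W') phi^2 grad rho)
        + kappa rho^(alpha - 4) |grad rho|^2 phi^2.
    For W = c0 rho^(alpha - 2) and h = - N / (2 rho) - 1 / (2 rho ln (r / rho))
    one finds kappa = c0^2 + c0 / (2 ln (r / rho)^2), which is the claim once the
    divergence integrates to zero.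

    The vector field is singular only at the origin, so W is multiplied by a cutoff
    chi_e = (1 - e / rho^(2 (1 + gamma)))_+^3, which makes the field and the terms of
    its divergence continuous with compact support.  The cutoff costs an error
    bounded by e^d rho^(-s) with s < Q; its integral is O(e^d), since
    rho^(-s) <= C prod_i |z_i|^(- s / Q).  Monotone convergence as e -> 0 concludes.

    A partial derivative of a compactly supported function integrates to zero
    because difference quotients converge uniformly and the iterated integral is
    translation invariant; no Fubini theorem is needed. *)

Require Import Defs.
From HB Require Import structures.
From mathcomp Require Import all_boot all_order all_algebra.
From mathcomp Require Import all_classical all_reals all_analysis.
From mathcomp Require Import measurable_realfun ring lra.
Import Order.TTheory GRing.Theory Num.Theory.
Import numFieldNormedType.Exports.
Local Open Scope classical_set_scope.
Local Open Scope ring_scope.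

(** * One-dimensional integrals of continuous functions with compact support *)

Section one_dim.
Variable R : realType.
Notation mu := (@lebesgue_measure R).

(** The integral of a nonnegative function is a supremum over the simple functions below it, so
    monotonicity needs no measurability. This matters for the inner integrals in [iint], which are
    not known to be measurable. *)
Lemma ge0_le_integral_nomeas (f g : R -> \bar R) :
  (forall t, 0 <= f t)%E -> (forall t, f t <= g t)%E ->
  (\int[mu]_(t in [set: R]) f t <= \int[mu]_(t in [set: R]) g t)%E.
Proof.
move=> f0 fg; rewrite !ge0_integralTE//; last by move=> t; exact: le_trans (fg t).
by apply: ereal_sup_le => _ [h hf <-]; exists h => // t; exact: le_trans (fg t).
Qed.

Definition ccs (F : R -> R) := continuous F /\ exists M : R, forall t, M < `|t| -> F t = 0.

Lemma box_restrict (F : R -> R) (M : R) : (forall t, M < `|t| -> F t = 0) ->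
  (EFin \o F) \_ `[- M, M] = EFin \o F.
Proof.
move=> FM; apply/funext => t; rewrite patchE; case: ifPn => // /negP tM.
rewrite /= FM// ltNge; apply/negP => tM'; apply: tM; rewrite inE /= in_itv /=.
by rewrite -ler_norml.
Qed.

Lemma ccs_integrable (F : R -> R) : ccs F -> mu.-integrable setT (EFin \o F).
Proof.
move=> [cF [M FM]]; rewrite -(box_restrict F M)//.
apply: (proj1 (@integrable_mkcond _ _ _ mu `[- M, M] _ _)) => //.
apply: (@continuous_compact_integrable R F); first exact: segment_compact.
exact: continuous_subspaceT.
Qed.

Lemma ccs_integral_fin (F : R -> R) : ccs F ->
  (\int[mu]_(t in [set: R]) (F t)%:E)%E \is a fin_num.
Proof. by move=> /ccs_integrable; exact: integrable_fin_num. Qed.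

Lemma ccs_integral_bound (F : R -> R) (M c : R) : 0 <= M -> 0 <= c -> ccs F ->
  (forall t, M < `|t| -> F t = 0) -> (forall t, `|F t| <= c) ->
  `|fine (\int[mu]_(t in [set: R]) (F t)%:E)%E| <= c * (2 * M).
Proof.
move=> M0 c0 cF FM Fc.
rewrite -lee_fin -abse_EFin fineK ?ccs_integral_fin//.
have -> : (\int[mu]_(t in [set: R]) (F t)%:E = \int[mu]_(t in `[(- M)%R, M]) (F t)%:E)%E.
  by rewrite [RHS]integral_mkcond -[X in integral mu setT X](box_restrict F M).
have iF : mu.-integrable `[- M, M] (EFin \o F).
  apply: (proj2 (@integrable_mkcond _ _ _ mu `[- M, M] _ _)) => //.
  by rewrite box_restrict//; exact: ccs_integrable.
apply: le_trans (le_abse_integral _ _ _) _ => //; first exact: measurable_int iF.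
apply: (@le_trans _ _ (\int[mu]_(t in `[(- M)%R, M]) (cst c%:E t))%E).
  apply: ge0_le_integral => //=.
  - have /measurable_int mF := iF.
    by apply: (@measurableT_comp _ _ _ _ _ _ (@abse R) _ (EFin \o F) _ mF).
  - by move=> x _; rewrite lee_fin.
rewrite integral_cst//= lebesgue_measure_itv/=.
case: ifPn => [_|_]; last by rewrite mule0 lee_fin; nra.
by rewrite -EFinB -EFinM lee_fin; nra.
Qed.

(** Substitution t -> t + h on a bounded interval that is large enough for neither integral to lose
    anything. *)
Lemma ccs_integral_shift (F : R -> R) (h : R) : ccs F ->
  (\int[mu]_(t in [set: R]) (F (t + h))%:E = \int[mu]_(t in [set: R]) (F t)%:E)%E.
Proof.
move=> [cF [M0 FM0]].
(* The margin [|h|] makes F vanish off [- M + h, M + h] and its translate vanish off [- M, M]; the 1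
   keeps M positive. *)
pose M := `|M0| + `|h| + 1.
have FM t : M - `|h| - 1 < `|t| -> F t = 0.
  by move=> Mt; apply: FM0; rewrite /M in Mt; have := ler_norm M0; lra.
have dsh x : is_derive x (1 : R) (fun t : R => t + h) 1.
  by apply: (is_derive_eq (is_deriveD _ _)); rewrite addr0.
have -> : (\int[mu]_(t in [set: R]) (F t)%:E =
    \int[mu]_(t in `[(- M + h)%R, (M + h)%R]) (F t)%:E)%E.
  rewrite [RHS]integral_mkcond; congr (integral mu setT _).
  apply/funext => t; rewrite patchE; case: ifPn => // /negP tM.
  rewrite /= FM// ltNge; apply/negP => tM'; apply: tM; rewrite inE /= in_itv /=.
  move: tM'; rewrite ler_norml => /andP[? ?].
  have := ler_norm h; have := ler_norm (- h); rewrite normrN => ? ?.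
  by apply/andP; split; lra.
have M_gt0 : 0 < M by rewrite /M; have := normr_ge0 M0; have := normr_ge0 h; lra.
have dE : ((fun t : R => t + h)^`())%classic = cst 1.
  by apply/funext => x; rewrite derive1E derive_val.
rewrite (@integration_by_substitution_increasing R (fun t => t + h) F (- M) M) => //.
- rewrite dE; transitivity (\int[mu]_(t in `[(- M)%R, M]) (F (t + h))%:E)%E; last first.
    by apply: eq_integral => t _ /=; rewrite mulr1.
  rewrite [RHS]integral_mkcond; congr (integral mu setT _).
  apply/funext => t; rewrite patchE; case: ifPn => // /negP tM.
  rewrite /= FM// ltNge; apply/negP => tM'; apply: tM; rewrite inE /= in_itv /=.
  move: tM'; rewrite ler_norml => /andP[? ?].
  have := ler_norm h; have := ler_norm (- h); rewrite normrN => ? ?.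
  by apply/andP; split; lra.
- by lra.
- by move=> x y _ _ xy; rewrite ltrD2r.
- by rewrite dE => x _; exact: cst_continuous.
- by rewrite dE; exact: is_cvg_cst.
- by rewrite dE; exact: is_cvg_cst.
- have csh x : {for x, continuous (fun t : R => t + h)}.
    apply: differentiable_continuous; apply/derivable1_diffP.
    by case: (dsh x).
  split.
  + by move=> x _; case: (dsh x).
  + by apply: cvg_at_right_filter; exact: csh.
  + by apply: cvg_at_left_filter; exact: csh.
- exact: continuous_subspaceT.
Qed.

End one_dim.
(** * Iterated integrals of compactly supported functions *)

Section iterated_integral.
Variable R : realType.
Notation mu := (@lebesgue_measure R).

(** Names the point at which [iint] evaluates its integrand, so that slices can be handled by
    coordinates. *)
Definition vcons (p : nat) (t : R) (v : 'rV[R]_p) : 'rV[R]_p.+1 :=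
  row_mx (const_mx t : 'rV_1) v.
Arguments vcons {p}.

Lemma vcons0 p t (v : 'rV[R]_p) : vcons t v 0 ord0 = t.
Proof.
rewrite /vcons; have -> : ord0 = lshift p (ord0 : 'I_1) by exact/val_inj.
by apply: etrans (row_mxEl _ _ _ _) _; rewrite mxE.
Qed.

Lemma vconsS p t (v : 'rV[R]_p) i : vcons t v 0 (lift ord0 i) = v 0 i.
Proof.
rewrite /vcons; have -> : lift ord0 i = rshift 1 i by exact/val_inj.
exact: (row_mxEr (const_mx t : 'rV_1) v).
Qed.

Lemma coord_add_delta p (v : 'rV[R]_p) (h : R) j i :
  (v + h *: delta_mx 0 j) 0 i = v 0 i + h * (i == j)%:R.
Proof. by rewrite !mxE eqxx. Qed.

Lemma vconsDe0 p t (v : 'rV[R]_p) (h : R) :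
  vcons t v + h *: delta_mx 0 ord0 = vcons (t + h) v.
Proof.
apply/rowP => i; rewrite coord_add_delta.
case: (unliftP ord0 i) => [j|] ->; first by rewrite !vconsS mulr0 addr0.
by rewrite !vcons0 eqxx mulr1.
Qed.

Lemma vconsDeS p t (v : 'rV[R]_p) (h : R) j :
  vcons t v + h *: delta_mx 0 (lift ord0 j) = vcons t (v + h *: delta_mx 0 j).
Proof.
apply/rowP => i; rewrite coord_add_delta.
case: (unliftP ord0 i) => [l|] ->; last by rewrite !vcons0 mulr0 addr0.
by rewrite !vconsS coord_add_delta (inj_eq lift_inj).
Qed.

(** The distance is expressed by coordinates, so that the property passes to slices and translates
    at once. *)
Definition unifc (p : nat) (f : 'rV[R]_p -> R) := forall e : R, 0 < e ->
  exists2 d : R, 0 < d &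
  forall z z' : 'rV[R]_p, (forall i, `|z 0 i - z' 0 i| < d) -> `|f z - f z'| < e.

Definition supp_in_box (p : nat) (M : R) (f : 'rV[R]_p -> R) :=
  forall z : 'rV[R]_p, (exists i, M < `|z 0 i|) -> f z = 0.

(* The class of functions (uniformly continuous, supported in a box) on which the
   extended-real iterated integral is finite; [Iint] is its real value. *)
Definition ucs (p : nat) (f : 'rV[R]_p -> R) := unifc p f /\ exists M, supp_in_box p M f.
Arguments unifc {p}.
Arguments supp_in_box {p}.
Arguments ucs {p}.

Lemma supp_in_box_le p (f : 'rV[R]_p -> R) M M' :
  M <= M' -> supp_in_box M f -> supp_in_box M' f.
Proof. by move=> MM' fM z [i zi]; apply: fM; exists i; exact: le_lt_trans zi. Qed.

Lemma ucs_box p (f : 'rV[R]_p -> R) : ucs f -> exists2 M, 0 <= M & supp_in_box M f.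
Proof.
move=> [_ [M fM]]; exists `|M|; first exact: normr_ge0.
exact: supp_in_box_le (ler_norm _) fM.
Qed.

Lemma ucs_lin p (f g : 'rV[R]_p -> R) (a : R) :
  ucs f -> ucs g -> ucs (fun z => a * f z + g z).
Proof.
move=> ucsf ucsg; have [Mf Mf0 fM] := ucs_box _ _ ucsf; have [Mg Mg0 gM] := ucs_box _ _ ucsg.
have [[uf _] [ug _]] := (ucsf, ucsg).
split; last first.
  exists (Mf + Mg) => z zM.
  by rewrite (supp_in_box_le _ f _ (Mf + Mg) _ fM)//
     ?(supp_in_box_le _ g _ (Mf + Mg) _ gM)//; lra.
move=> e e0; have a1 : 0 < `|a| + 1 by have := normr_ge0 a; lra.
have [|d1 d10 H1] := uf (e / 2 / (`|a| + 1)); first by rewrite !divr_gt0.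
have [|d2 d20 H2] := ug (e / 2); first by rewrite divr_gt0.
exists (Num.min d1 d2); first by rewrite lt_min d10.
move=> z z' zz'.
have -> : a * f z + g z - (a * f z' + g z') = a * (f z - f z') + (g z - g z') by ring.
have /H1 {}H1 : forall i, `|z 0 i - z' 0 i| < d1.
  by move=> i; move: (zz' i); rewrite lt_min => /andP[].
have /H2 {}H2 : forall i, `|z 0 i - z' 0 i| < d2.
  by move=> i; move: (zz' i); rewrite lt_min => /andP[].
apply: le_lt_trans (ler_normD _ _) _; rewrite normrM.
rewrite ltr_pdivlMr// in H1.
have := normr_ge0 (f z - f z'); nra.
Qed.

Lemma ucs0 p : ucs (fun _ : 'rV[R]_p => 0).
Proof.
split; last by exists 0.
by move=> e e0; exists 1 => // z z' _; rewrite subrr normr0.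
Qed.

Lemma ucs_max0 p (f : 'rV[R]_p -> R) : ucs f -> ucs (fun z => Num.max 0 (f z)).
Proof.
move=> [uf [M fM]]; split; last by exists M => z /fM ->; rewrite maxxx.
move=> e /uf[d d0 H]; exists d => // z z' /H.
apply: le_lt_trans.
have := ler_norm (f z - f z'); have := ler_norm (- (f z - f z')).
rewrite normrN ler_norml !maxEle.
by case: (leP 0 (f z)); case: (leP 0 (f z')) => ? ? ? ?; apply/andP; split; lra.
Qed.

Lemma ucs_slice p (f : 'rV[R]_p.+1 -> R) t : ucs f -> ucs (fun v => f (vcons t v)).
Proof.
move=> [uf [M fM]]; split.
  move=> e /uf[d d0 H]; exists d => // z z' zz'; apply: H => i.
  by case: (unliftP ord0 i) => [j|] ->; rewrite ?vconsS// !vcons0 subrr normr0.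
by exists M => v [i vi]; apply: fM; exists (lift ord0 i); rewrite vconsS.
Qed.

Definition Iint (p : nat) (f : 'rV[R]_p -> R) : R := fine (iint (EFin \o f)).
Arguments Iint {p}.

(** The bound enters as a hypothesis because this is used inside the induction that establishes
    it. *)
Lemma Iint0_aux p :
  (forall (f : 'rV[R]_p -> R) M c, 0 <= M -> 0 <= c -> ucs f -> supp_in_box M f ->
       (forall z, `|f z| <= c) -> `|Iint f| <= c * (2 * M) ^+ p) ->
  Iint (fun _ : 'rV[R]_p => 0) = 0.
Proof.
move=> H; apply/eqP; rewrite -normr_le0.
have := H (fun=> 0) 0 0 (lexx _) (lexx _) (ucs0 p).
by rewrite !mul0r; apply => // z; rewrite normr0.
Qed.

(** By uniform continuity, slices at nearby t are uniformly close; linearity and the sup bound in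
    dimension p turn this into closeness of their integrals. Both are hypotheses since they serve as
    induction hypotheses below. *)
Lemma slice_ccs_aux p :
  (forall (f g : 'rV[R]_p -> R) a, ucs f -> ucs g ->
       Iint (fun z => a * f z + g z) = a * Iint f + Iint g) ->
  (forall (f : 'rV[R]_p -> R) M c, 0 <= M -> 0 <= c -> ucs f -> supp_in_box M f ->
       (forall z, `|f z| <= c) -> `|Iint f| <= c * (2 * M) ^+ p) ->
  forall f : 'rV[R]_p.+1 -> R, ucs f -> ccs R (fun t => Iint (fun v => f (vcons t v))).
Proof.
move=> IHlin IHb f.
move=> ucsf; have [M M0 fM] := ucs_box _ _ ucsf.
have bs t : supp_in_box M (fun v => f (vcons t v)).
  by move=> v [i vi]; apply: fM; exists (lift ord0 i); rewrite vconsS.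
split; last first.
  exists M => t tM; rewrite (_ : (fun v => _) = (fun=> 0)).
    exact: Iint0_aux.
  by apply/funext => v; apply: fM; exists ord0; rewrite vcons0.
move=> t; apply/cvgrPdist_lt => e e0.
pose C := (2 * M) ^+ p + 1; have C0 : 0 < C.
  by rewrite /C ltr_wpDl// exprn_ge0// mulr_ge0.
have [|d d0 H] := ucsf.1 (e / C); first by rewrite divr_gt0.
near=> s.
have -> : Iint (fun v => f (vcons t v)) - Iint (fun v => f (vcons s v)) =
    Iint (fun v => -1 * f (vcons s v) + f (vcons t v)).
  by rewrite IHlin ?mulN1r 1?addrC//; exact: ucs_slice.
apply: le_lt_trans (IHb _ M (e / C) M0 _ _ _ _) _.
- by rewrite ltW// divr_gt0.
- by apply: ucs_lin; exact: ucs_slice.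
- by move=> z zM; rewrite !bs// mulr0 addr0.
- move=> z; rewrite mulN1r addrC; apply/ltW/H => i.
  case: (unliftP ord0 i) => [j|] ->; rewrite ?vconsS ?subrr ?normr0// !vcons0.
  by near: s; apply: (@cvgr_dist_lt _ _ _ (nbhs t) _ id).
- by rewrite mulrAC ltr_pdivrMr// ltr_pM2l// /C ltrDl.
Unshelve. all: by end_near. Qed.

(** The three properties are proved together: continuity of the slice integrals uses linearity and
    the bound in dimension p, and in turn gives finiteness, linearity and the bound in dimension p +
    1. *)
Lemma Iint_properties p :
  [/\ forall f : 'rV[R]_p -> R, ucs f -> iint (EFin \o f) = (Iint f)%:E,
     forall (f g : 'rV[R]_p -> R) a, ucs f -> ucs g ->
       Iint (fun z => a * f z + g z) = a * Iint f + Iint g &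
     forall (f : 'rV[R]_p -> R) M c, 0 <= M -> 0 <= c -> ucs f -> supp_in_box M f ->
       (forall z, `|f z| <= c) -> `|Iint f| <= c * (2 * M) ^+ p].
Proof.
elim: p => [|p [IHE IHlin IHb]].
  by split => // f M c _ _ _ _ fc; rewrite expr0 mulr1; exact: fc.
have slice := slice_ccs_aux p IHlin IHb.
have E1 (f : 'rV[R]_p.+1 -> R) : ucs f ->
    iint (EFin \o f) = (\int[mu]_(t in [set: R]) (Iint (fun v => f (vcons t v)))%:E)%E.
  move=> ucsf /=; apply: eq_integral => t _.
  by rewrite -IHE//; exact: ucs_slice.
split.
- by move=> f ucsf; rewrite /Iint fineK// E1// ccs_integral_fin//; exact: slice.
- move=> f g a ucsf ucsg; rewrite /Iint !E1//; last exact: ucs_lin.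
  under eq_integral => t _ do
    rewrite (IHlin _ _ a (ucs_slice _ f t ucsf) (ucs_slice _ g t ucsg)) EFinD EFinM.
  have if_ := ccs_integrable _ _ (slice _ ucsf).
  have ig := ccs_integrable _ _ (slice _ ucsg).
  rewrite integralD//; last exact: integrableZl.
  rewrite integralZl// fineD ?fineM//.
  + exact: integrable_fin_num.
  + by apply: fin_numM => //; exact: integrable_fin_num.
  + exact: integrable_fin_num.
- move=> f M c M0 c0 ucsf fM fc.
  rewrite /Iint E1// exprSr mulrA; apply: ccs_integral_bound => //.
  + by rewrite mulr_ge0// exprn_ge0// mulr_ge0.
  + exact: slice.
  + move=> t tM; rewrite (_ : (fun v => _) = (fun=> 0)).
      exact: Iint0_aux.
    by apply/funext => v; apply: fM; exists ord0; rewrite vcons0.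
  + move=> t; apply: IHb => //; first exact: ucs_slice.
    by move=> v [i vi]; apply: fM; exists (lift ord0 i); rewrite vconsS.
Qed.

Lemma iintE p (f : 'rV[R]_p -> R) : ucs f -> iint (EFin \o f) = (Iint f)%:E.
Proof. by case: (Iint_properties p) => + _ _; exact. Qed.

Lemma Iint_lin p (f g : 'rV[R]_p -> R) a : ucs f -> ucs g ->
  Iint (fun z => a * f z + g z) = a * Iint f + Iint g.
Proof. by case: (Iint_properties p) => _ + _; exact. Qed.

Lemma Iint_bound p (f : 'rV[R]_p -> R) M c : 0 <= M -> 0 <= c -> ucs f -> supp_in_box M f ->
  (forall z, `|f z| <= c) -> `|Iint f| <= c * (2 * M) ^+ p.
Proof. by case: (Iint_properties p) => _ _ +; exact. Qed.

Lemma Iint0 p : Iint (fun _ : 'rV[R]_p => 0) = 0.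
Proof. exact: Iint0_aux (Iint_bound p). Qed.

Lemma iintS p (f : 'rV[R]_p.+1 -> R) : ucs f ->
  iint (EFin \o f) = (\int[mu]_(t in [set: R]) (Iint (fun v => f (vcons t v)))%:E)%E.
Proof.
move=> ucsf /=; apply: eq_integral => t _.
by rewrite -iintE//; exact: ucs_slice.
Qed.

Lemma slice_ccs p (f : 'rV[R]_p.+1 -> R) : ucs f ->
  ccs R (fun t => Iint (fun v => f (vcons t v))).
Proof. by apply: slice_ccs_aux; [exact: Iint_lin|exact: Iint_bound]. Qed.

Lemma iint_ge0 p (f : 'rV[R]_p -> \bar R) : (forall z, 0 <= f z)%E -> (0 <= iint f)%E.
Proof.
elim: p f => [|p IH] f f0 /=; first exact: f0.
by apply: integral_ge0 => t _; apply: IH.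
Qed.

Lemma le_iint p (f g : 'rV[R]_p -> \bar R) :
  (forall z, 0 <= f z)%E -> (forall z, f z <= g z)%E -> (iint f <= iint g)%E.
Proof.
elim: p f g => [|p IH] f g f0 fg /=; first exact: fg.
apply: ge0_le_integral_nomeas => t; first exact: iint_ge0.
exact: IH.
Qed.

Lemma ler_Iint p (f g : 'rV[R]_p -> R) : ucs f -> ucs g ->
  (forall z, f z <= g z) -> Iint f <= Iint g.
Proof.
move=> ucsf ucsg fg; rewrite -subr_ge0 addrC -mulN1r -Iint_lin//.
rewrite -lee_fin -iintE; last exact: ucs_lin.
by apply: iint_ge0 => z; rewrite lee_fin mulN1r addrC subr_ge0.
Qed.

(** Induction on the dimension: a shift of the first coordinate is the one-dimensional invariance of
    the outer integral, any other shift acts on the slices. *)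
Lemma Iint_shift p (f : 'rV[R]_p -> R) (i : 'I_p) (h : R) : ucs f ->
  ucs (fun z => f (z + h *: delta_mx 0 i)) /\
  Iint (fun z => f (z + h *: delta_mx 0 i)) = Iint f.
Proof.
have ucs_shift q (k : 'rV[R]_q -> R) (j : 'I_q) : ucs k ->
    ucs (fun z => k (z + h *: delta_mx 0 j)).
  move=> ucsk; have [M M0 kM] := ucs_box _ _ ucsk; split.
    move=> e /ucsk.1[d d0 H]; exists d => // z z' zz'; apply: H => l.
    by rewrite !coord_add_delta opprD addrACA subrr addr0.
  exists (M + `|h|) => z [l zl]; apply: kM; exists l; rewrite coord_add_delta.
  have := ler_normB (z 0 l + h * (l == j)%:R) (h * (l == j)%:R).
  rewrite addrK.
  have : `|h * (l == j)%:R| <= `|h|.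
    by case: eqP => _; rewrite ?mulr1// mulr0 normr0.
  by lra.
move=> ucsf; split; first exact: ucs_shift.
elim: p f i ucsf => [|p IH] f i ucsf; first by case: i.
rewrite /Iint; congr fine; rewrite !iintS//; last exact: ucs_shift.
case: (unliftP ord0 i) => [j|] ->.
  apply: eq_integral => t _; congr (_%:E).
  under [in LHS]eq_fun do rewrite vconsDeS.
  by apply: IH; exact: ucs_slice.
under eq_integral => t _ do under eq_fun do rewrite vconsDe0.
by rewrite (ccs_integral_shift _ (fun t => Iint (fun v => f (vcons t v))))//; exact: slice_ccs.
Qed.

End iterated_integral.
Arguments vcons {R p}.
Arguments unifc {R p}.
Arguments supp_in_box {R p}.
Arguments ucs {R p}.
Arguments Iint {R p}.
Arguments ccs {R}.

Set Implicit Arguments.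
Unset Strict Implicit.

(** * Uniform continuity, integrals of derivatives, and limits and comparison for iterated
    integrals *)

Section continuity_and_derivatives.
Variable R : realType.

Lemma continuous_ucs p (f : 'rV[R]_p -> R) (M : R) :
  continuous f -> supp_in_box M f -> ucs f.
Proof.
move=> cf fM; split; last by exists M.
move=> e e0.
(* The box is enlarged by 1 so that two points at distance below 1, one of them outside K, both lie
   where f vanishes. *)
pose K : set 'rV[R]_p := [set v | forall i, v ord0 i \in `[- (M + 1), M + 1]].
have cK : compact K.
  apply: (@rV_compact _ _ (fun=> `[- (M + 1), M + 1]%classic)) => _.
  exact: segment_compact.
(* Compactness as a near-covering property: a modulus valid near each point of K yields one radius
   for all of K. *)
have [] := (compact_near_coveringP K).1 cK R (0 : R)^'+
   (fun d z => forall z', ball z d z' -> `|f z - f z'| < e) _ _.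
  move=> z Kz.
  have /cvgrPdist_lt/(_ (e / 2)) := cf z; rewrite divr_gt0// => /(_ isT).
  rewrite -nbhs_ballE => -[d /= d0 H].
  near=> z1 d1 => /= z' zz'.
  have /H : ball z d z1.
    apply: (@le_ball _ _ _ (d / 2)); first by rewrite ler_pdivrMr// ler_pMr// ler1n.
    by near: z1; apply: nbhsx_ballx; rewrite divr_gt0.
  have /H : ball z d z'.
    apply: (@ball_split _ _ z1).
      by near: z1; apply: nbhsx_ballx; rewrite divr_gt0.
    apply: le_ball zz'; near: d1.
    by apply: nbhs_right_le; rewrite divr_gt0.
  rewrite /=.
  have -> : f z1 - f z' = (f z - f z') - (f z - f z1) by ring.
  move=> h1 h2; apply: le_lt_trans (ler_normB _ _) _; lra.
move=> d /= d0 H.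
exists (Num.min (d / 2) 1); first by rewrite lt_min ltr01 divr_gt0.
move=> z z' zz'.
have [Kz|nKz] := pselect (K z).
  apply: (H (d / 2)) => //=.
  - by rewrite sub0r normrN gtr0_norm ?divr_gt0// ltr_pdivrMr// ltr_pMr// ltr1n.
  - by rewrite divr_gt0.
  - split; first by rewrite divr_gt0.
    by move=> i j; rewrite ord1; move: (zz' j); rewrite lt_min => /andP[].
have [i Hi] : exists i, M + 1 < `|z 0 i|.
  apply: contrapT => /forallNP h; apply: nKz => i /=.
  by rewrite in_itv /= -ler_norml leNgt; apply/negP/h.
rewrite !fM ?subrr ?normr0//.
  exists i; have := zz' i; rewrite lt_min => /andP[_].
  have := ler_normD (z 0 i - z' 0 i) (z' 0 i).
  by rewrite subrK; lra.
by exists i; lra.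
Unshelve. all: by end_near. Qed.

(** Both derivatives are limits of the same difference quotient; this gives access to the mean value
    theorem and the one-variable chain rule. *)
Lemma is_derive_line p (V : 'rV[R]_p -> R) (z v : 'rV[R]_p) (t : R) (d : R) :
  is_derive t (1 : R) (fun s : R => V (z + s *: v)) d <-> is_derive (z + t *: v) v V d.
Proof.
have E : (fun h : R => h^-1 *: (((fun s : R => V (z + s *: v)) \o shift t) (h *: (1 : R))
      - V (z + t *: v))) =
    (fun h : R => h^-1 *: ((V \o shift (z + t *: v)) (h *: v) - V (z + t *: v))).
  apply/funext => h /=; congr (_ *: (V _ - _)).
  by rewrite scaler1 scalerDl addrCA.
split=> -[dV <-]; (apply: DeriveDef; [move: dV; rewrite /derivable E//|rewrite /derive E//]).
Qed.

(* Difference quotients in direction i have integral zero by translation invariance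
   and converge uniformly to D by the mean value theorem. *)
Lemma Iint_div p (V D : 'rV[R]_p -> R) (i : 'I_p) : ucs V -> ucs D ->
  (forall z, is_derive z (delta_mx 0 i : 'rV[R]_p) V (D z)) -> Iint D = 0.
Proof.
move=> uV uD dV; have [MV MV0 VM] := ucs_box _ _ _ uV; have [MD MD0 DM] := ucs_box _ _ _ uD.
apply/eqP; rewrite -normr_le0; apply/ler_addgt0Pr => e e0; rewrite add0r.
pose M := MV + MD + 1.
pose C := (2 * M) ^+ p + 1; have C0 : 0 < C.
  by rewrite /C ltr_wpDl// exprn_ge0// /M; lra.
have [|d d0 H] := uD.1 (e / C); first by rewrite divr_gt0.
(* h < d keeps the mean value point within the modulus of continuity of D, and h <= 1 keeps the
   shifted support in the box of size M. *)
pose h := Num.min (d / 2) 1.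
have h0 : 0 < h by rewrite lt_min ltr01 divr_gt0.
have hd : h < d by rewrite gt_min ltr_pdivrMr// ltr_pMr// ltr1n.
have h1 : h <= 1 by rewrite ge_min lexx orbT.
pose Vh z := V (z + h *: delta_mx 0 i).
have [uVh IVh] := Iint_shift _ _ V i h uV.
pose g z := - h^-1 * Vh z + (h^-1 * V z + D z).
have uhVD : ucs (fun z => h^-1 * V z + D z) by exact: ucs_lin.
have ug : ucs g by exact: ucs_lin.
have <- : Iint g = Iint D by rewrite /g !Iint_lin// IVh; ring.
have M0 : 0 <= M by rewrite /M; lra.
apply: le_trans (@Iint_bound _ _ g M (e / C) M0 _ ug _ _) _.
- by rewrite ltW// divr_gt0.
- move=> z [j zj]; rewrite /g /Vh VM ?VM ?DM ?mulr0 ?addr0//.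
  + by exists j; rewrite /M in zj; lra.
  + by exists j; rewrite /M in zj; lra.
  + exists j; rewrite coord_add_delta; move: zj; rewrite /M => zj.
    have := ler_normB (z 0 j + h * (j == i)%:R) (h * (j == i)%:R); rewrite addrK.
    have : `|h * (j == i)%:R| <= 1.
      by case: eqP => _; rewrite ?mulr1 ?mulr0 ?normr0// gtr0_norm.
    by lra.
- move=> z.
  have dl t : is_derive t (1 : R) (fun s : R => V (z + s *: delta_mx 0 i))
      (D (z + t *: delta_mx 0 i)) by apply/is_derive_line.
  have [|c] := @MVT R (fun s : R => V (z + s *: delta_mx 0 i))
      (fun t => D (z + t *: delta_mx 0 i)) 0 h h0 (fun t _ => dl t).
    apply: continuous_subspaceT => t; apply: differentiable_continuous.
    by apply/derivable1_diffP; case: (dl t).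
  rewrite in_itv /= => /andP[c0 ch]; rewrite subr0 scale0r addr0 => E.
  have -> : g z = D z - D (z + c *: delta_mx 0 i).
    have -> : g z = D z - (Vh z - V z) / h by rewrite /g; ring.
    by rewrite /Vh E mulfK// gt_eqF.
  apply/ltW/H => j; rewrite coord_add_delta opprD addNKr normrN.
  by case: eqP => _; rewrite ?mulr1 ?mulr0 ?normr0// gtr0_norm//; lra.
- by rewrite mulrAC ler_pdivrMr// ler_pM2l// /C lerDl.
Qed.

Lemma measurable_slice p (f : 'rV[R]_p.+1 -> R) (D : set R) : ucs f ->
  measurable_fun D (EFin \o (fun t => Iint (fun v => f (vcons t v)))).
Proof.
move=> uf; apply: measurable_funTS; apply/measurable_EFinP.
by apply: continuous_measurable_fun; case: (slice_ccs _ _ _ uf).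
Qed.

(** Monotone convergence, one coordinate at a time. Deleting t = 0 from each integration is
    harmless, so convergence is only asked off the coordinate hyperplanes; measurability of the
    limit integrals comes from their being pointwise limits. *)
Lemma iint_cvg p (f_ : nat -> 'rV[R]_p -> R) (f : 'rV[R]_p -> \bar R) :
  (forall n, ucs (f_ n)) -> (forall n z, 0 <= f_ n z) ->
  (forall z, nondecreasing_seq (f_^~ z)) ->
  (forall z : 'rV[R]_p, (forall i, z 0 i != 0) -> (f_ n z)%:E @[n --> \oo] --> f z) ->
  iint (EFin \o f_ n) @[n --> \oo] --> iint f.
Proof.
elim: p f_ f => [|p IH] f_ f uf f0 nf cf; first by apply: cf => -[].
pose D : set R := [set: R] `\ 0.
have mD : measurable D by apply: measurableD.
pose F_ n t := iint (fun v => (f_ n (vcons t v))%:E).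
have F0 n t : D t -> (0 <= F_ n t)%E by move=> _; apply: iint_ge0 => z; rewrite lee_fin.
have nF t : D t -> {homo F_^~ t : n m / (n <= m)%N >-> (n <= m)%E}.
  by move=> _ n m nm; apply: le_iint => z; rewrite lee_fin// nf.
have FE n t : F_ n t = (Iint (fun v => f_ n (vcons t v)))%:E.
  by rewrite -iintE//; exact: ucs_slice.
have mF n : measurable_fun D (F_ n).
  rewrite (_ : F_ n = EFin \o (fun t => Iint (fun v => f_ n (vcons t v)))).
    apply: measurable_funTS.
    exact: measurable_slice.
  by apply/funext => t; rewrite FE.
have cF t : D t -> F_ n t @[n --> \oo] --> iint (fun v => f (vcons t v)).
  move=> [_ /= /eqP t0]; apply: (IH (fun n v => f_ n (vcons t v))) => //.
    by move=> n; exact: ucs_slice.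
  move=> v v0; apply: cf => i.
  by case: (unliftP ord0 i) => [j|] ->; rewrite ?vconsS// vcons0.
have -> : iint f = (\int[@lebesgue_measure R]_(t in D) limn (F_^~ t))%E.
  have mf : measurable_fun D (fun t => iint (fun v => f (vcons t v))).
    exact: (@emeasurable_fun_cvg _ _ _ D F_ _ mF cF).
  rewrite [LHS]/= -(@integral_setD1 R _ 0 setT mD mf).
  by apply: eq_integral => t /set_mem /cF cFt; apply/esym/cvg_lim.
have E n : iint (EFin \o f_ n) = (\int[@lebesgue_measure R]_(t in D) F_ n t)%E.
  exact: (esym (@integral_setD1 R (F_ n) 0 setT mD (mF n))).
under eq_fun do rewrite E.
exact: (@cvg_monotone_convergence _ _ _ (@lebesgue_measure R) D mD F_ mF F0 nF).
Qed.

(** Comparison off the coordinate hyperplanes with a function L of unknown measurability: t = 0 is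
    deleted only from the integral of P, which is measurable. *)
Lemma le_Iint_iint p (P : 'rV[R]_p -> R) (L : 'rV[R]_p -> \bar R) : ucs P ->
  (forall z, 0 <= L z)%E ->
  (forall z : 'rV[R]_p, (forall i, z 0 i != 0)%R -> (P z)%:E <= L z)%E ->
  ((Iint P)%:E <= iint L)%E.
Proof.
elim: p P L => [|p IH] P L uP L0 PL.
  by rewrite -iintE//; apply: PL => -[].
(* Monotonicity without measurability applies to nonnegative functions only, hence the positive
   part. *)
pose P' z := Num.max 0 (P z).
have uP' : ucs P' by exact: ucs_max0.
apply: (@le_trans _ _ (Iint P')%:E).
  by rewrite lee_fin; apply: ler_Iint => // z; rewrite le_max lexx orbT.
pose D : set R := [set: R] `\ 0.
have mD : measurable D by apply: measurableD.
rewrite -iintE// iintS// -(@integral_setD1 R _ 0 setT mD (measurable_slice uP')).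
rewrite integral_mkcond; apply: ge0_le_integral_nomeas => t; rewrite patchE; case: ifPn => // Dt.
- rewrite /= -iintE; last exact: ucs_slice.
  by apply: iint_ge0 => z; rewrite lee_fin le_max lexx.
- apply: IH => [|z|z z0]; [exact: ucs_slice|exact: L0|].
  rewrite /P' /= /Num.max; case: ifPn => _; last exact: L0.
  apply: PL => i; case: (unliftP ord0 i) => [j|] ->; first by rewrite vconsS.
  by rewrite vcons0; apply/eqP => t0; move: Dt; rewrite inE /D /= => -[].
- exact: iint_ge0.
Qed.

(** The constant c is general because in the induction it absorbs the factor h(t) of the outer
    coordinate. *)
Lemma iint_prod p (h : R -> R) (I c : R) : measurable_fun [set: R] h ->
  (forall t, 0 <= h t) -> (\int[@lebesgue_measure R]_(t in [set: R]) (h t)%:E = I%:E)%E ->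
  0 <= c -> iint (fun z : 'rV[R]_p => (c * \prod_i h (z 0 i))%:E) = (c * I ^+ p)%:E.
Proof.
move=> mh h0 hI; elim: p c => [|p IH] c c0; first by rewrite /= big_ord0 expr0.
have I0 : 0 <= I by rewrite -lee_fin -hI integral_ge0// => t _; rewrite lee_fin.
transitivity (\int[@lebesgue_measure R]_(t in [set: R]) ((c * I ^+ p)%:E * (h t)%:E))%E.
  apply: eq_integral => t _; rewrite -EFinM mulrAC -IH ?mulr_ge0//.
  congr iint; apply/funext => v; rewrite big_ord_recl vcons0 mulrA.
  by congr (_ * _)%:E; apply: eq_bigr => i _; congr h; rewrite -(vconsS R p t v i).
rewrite ge0_integralZl//.
- by rewrite hI -EFinM exprSr mulrA.
- exact/measurable_EFinP.
- by move=> t _; rewrite lee_fin.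
- by rewrite lee_fin mulr_ge0// exprn_ge0.
Qed.

End continuity_and_derivatives.

(** * Integrability of truncated negative powers on the line *)

(* [trunc_powRN th M 0 = 0] because [powR 0 x = 0] for x <> 0; this is harmless
   since all comparisons below are made at points with nonzero coordinates. *)
Section powR_integrability.
Variable R : realType.
Notation mu := (@lebesgue_measure R).

Lemma powR_continuous_gt0 (th t : R) : 0 < t -> {for t, continuous (fun x : R => powR x th)}.
Proof.
move=> t0; apply: differentiable_continuous; apply/derivable1_diffP.
by have [] := is_derive1_powR th t0.
Qed.

(** An antiderivative is t^(1 - th) / (1 - th); its value at a is nonnegative and is dropped, which
    makes the bound uniform in a. *)
Lemma integral_powR_le (th a M : R) : th < 1 -> 0 < a -> a < M ->
  (\int[mu]_(t in `[a, M]) (powR t (- th))%:E <= (powR M (1 - th) / (1 - th))%:E)%E.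
Proof.
move=> th1 a0 aM.
have dF (x : R) : 0 < x ->
    is_derive x 1 (fun t : R => (1 - th)^-1 * powR t (1 - th)) (powR x (- th)).
  move=> x0; have := is_deriveM (is_derive_cst ((1 - th)^-1 : R) x 1)
    (is_derive1_powR (1 - th) x0).
  move/is_derive_eq; apply.
  rewrite /GRing.scale /= mulr0 addr0 mulrA mulVf ?mul1r ?subr_eq0 ?gt_eqF//.
  by congr powR; ring.
have cF (x : R) : 0 < x -> {for x, continuous (fun t : R => (1 - th)^-1 * powR t (1 - th))}.
  move=> x0; apply: differentiable_continuous; apply/derivable1_diffP.
  by case: (dF x x0).
have cf : {within `[a, M], continuous (fun t : R => powR t (- th))}.
  apply: continuous_in_subspaceT => x /set_mem /=; rewrite in_itv /= => /andP[ax _].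
  by apply: powR_continuous_gt0; exact: lt_le_trans ax.
rewrite (@continuous_FTC2 R _ (fun t => (1 - th)^-1 * powR t (1 - th)) a M)//.
- rewrite -EFinB lee_fin [leRHS]mulrC lerBlDr lerDl mulr_ge0 ?powR_ge0//.
  by rewrite invr_ge0 subr_ge0 ltW.
- split.
  + by move=> x; rewrite in_itv /= => /andP[ax _]; case: (dF x (lt_trans a0 ax)).
  + by apply: cvg_at_right_filter; exact: cF.
  + by apply: cvg_at_left_filter; apply: cF; exact: lt_trans aM.
- move=> x; rewrite in_itv /= => /andP[ax _].
  by rewrite derive1E; case: (dF x (lt_trans a0 ax)).
Qed.

Definition trunc_powRN (th M t : R) : R := if `|t| <= M then powR `|t| (- th) else 0.

Lemma trunc_powRN_ge0 th M t : 0 <= trunc_powRN th M t.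
Proof. by rewrite /trunc_powRN; case: ifPn => // _; exact: powR_ge0. Qed.

Lemma measurable_norm_powR (th : R) : measurable_fun [set: R] (fun t : R => powR `|t| th).
Proof.
apply: (measurableT_comp (measurable_powR th)).
exact: normr_measurable.
Qed.

(** Monotone convergence along the sets a_n <= |t| <= M, on which the integrals are bounded by twice
    the one-sided bound. *)
Lemma integral_trunc_powRN (th M : R) : 0 < th -> th < 1 -> 0 < M ->
  measurable_fun [set: R] (trunc_powRN th M) /\
  exists I : R, (\int[mu]_(t in [set: R]) (trunc_powRN th M t)%:E = I%:E)%E.
Proof.
move=> th0 th1 M0.
(* The denominator starts at 2 so that a_n < M already for n = 0. *)
pose a n : R := M / n.+2%:R.
have a0 n : 0 < a n by rewrite divr_gt0.
have aM n : a n < M by rewrite ltr_pdivrMr// ltr_pMr// ltr1n.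
pose S n : set R := `[a n, M] `|` `[- M, - a n].
pose h n := (fun t : R => powR `|t| (- th)) \_ (S n).
have mS n : measurable (S n) by apply: measurableU.
have mh n : measurable_fun [set: R] (h n).
  apply: (measurable_restrictT _ (mS n)).1; apply: measurable_funTS.
  exact: measurable_norm_powR.
have Sin n (t : R) : (t \in S n) = (a n <= `|t| <= M).
  apply/idP/idP.
    rewrite inE => -[] /=; rewrite in_itv /= => /andP[h1 h2].
      by rewrite ger0_norm ?h1 ?h2// (le_trans _ h1)// ltW.
    by rewrite ler0_norm; [apply/andP; split; lra|have := a0 n; lra].
  move=> /andP[h1 h2]; rewrite inE /S /=; have [t0|t0] := leP 0 t.
    by left; rewrite in_itv /=; rewrite ger0_norm// in h1 h2; rewrite h1 h2.
  right; rewrite in_itv /=; rewrite ltr0_norm// in h1 h2; apply/andP; split; lra.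
have hn n t : h n t = if (a n <= `|t| <= M) then powR `|t| (- th) else 0.
  by rewrite /h patchE Sin.
have h0 n t : 0 <= h n t by rewrite hn; case: ifPn => // _; exact: powR_ge0.
have ndh t : {homo (fun n => (h n t)%:E) : n m / (n <= m)%N >-> (n <= m)%E}.
  move=> n m nm; rewrite lee_fin !hn; case: ifPn => [/andP[h1 h2]|_]; last first.
    by case: ifPn => // _; exact: powR_ge0.
  rewrite ifT// h2 andbT (le_trans _ h1)// ler_pM2l// lef_pV2 ?posrE//.
  by rewrite ler_nat.
have ch t : (h n t)%:E @[n --> \oo] --> (trunc_powRN th M t)%:E.
  apply: cvg_EFin; first by near=> n.
  apply: cvg_near_cst; have [->|t0] := eqVneq t 0.
    near=> n; rewrite /= hn /trunc_powRN normr0 powR0 ?oppr_eq0 ?gt_eqF//.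
    by case: ifP; case: ifP.
  have t0' : 0 < `|t| by rewrite normr_gt0.
  have ht : M / `|t| \is Num.real by rewrite num_real.
  near=> n; rewrite /= hn /trunc_powRN; case: (leP `|t| M) => _; last by rewrite andbF.
  rewrite andbT ifT//.
  rewrite /a ler_pdivrMr// mulrC -ler_pdivrMr//.
  apply: le_trans (_ : n%:R <= _); last by rewrite ler_nat leqW.
  by near: n; exact: nbhs_infty_ger.
have mhp : measurable_fun [set: R] (trunc_powRN th M).
  apply: measurable_fun_ifT => //; last exact: measurable_norm_powR.
  by apply: measurable_fun_ler => //; exact: normr_measurable.
split => //.
have := @cvg_monotone_convergence _ _ _ mu setT measurableT (fun n t => (h n t)%:E)
  (fun n => (measurable_EFinP _ _).2 (mh n)) (fun n t _ => h0 n t) (fun t _ => ndh t).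
have -> : (\int[mu]_(x in [set: R]) limn (fun n => (h n x)%:E) =
    \int[mu]_(t in [set: R]) (trunc_powRN th M t)%:E)%E.
  by apply: eq_integral => t _; apply/cvg_lim => //; exact: ch.
move=> cI.
pose K := powR M (1 - th) / (1 - th).
have hK n : (\int[mu]_(t in [set: R]) (h n t)%:E <= (K + K)%:E)%E.
  have -> : (\int[mu]_(t in [set: R]) (h n t)%:E =
     \int[mu]_(t in S n) (powR `|t| (- th))%:E)%E.
    by rewrite [RHS]integral_mkcond restrict_EFin.
  rewrite ge0_integral_setU//=; last 2 first.
  - by apply/measurable_EFinP; apply: measurable_funTS; exact: measurable_norm_powR.
  - apply/disj_setPLR => t /=; rewrite in_itv /= => /andP[h1 _].
    by rewrite in_itv /= => /andP[_ h2]; have := a0 n; lra.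
  have I1 : (\int[mu]_(t in `[a n, M]) (powR `|t| (- th))%:E <= K%:E)%E.
    have -> : (\int[mu]_(t in `[a n, M]) (powR `|t| (- th))%:E =
        \int[mu]_(t in `[a n, M]) (powR t (- th))%:E)%E.
      apply: eq_integral => t /set_mem /=; rewrite in_itv /= => /andP[h1 _].
      by rewrite ger0_norm// ltW// (lt_le_trans _ h1).
    exact: integral_powR_le.
  rewrite EFinD; apply: leeD => //.
  (* Reflection reduces the negative half to the bound [I1] on the positive half. *)
  rewrite integration_by_substitution_oppr; last 2 first.
  - exact: ltW.
  - apply: continuous_in_subspaceT => x /set_mem /=; rewrite in_itv /= => /andP[_ xa].
    apply: (@continuous_comp _ _ _ (fun x : R => `|x|) (fun x => powR x (- th))).
      exact: norm_continuous.
    by apply: powR_continuous_gt0; rewrite normr_gt0; have := a0 n; apply/contraTneq => ?; lra.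
  by under eq_integral do rewrite /= normrN.
have Ifin : (\int[mu]_(t in [set: R]) (trunc_powRN th M t)%:E)%E \is a fin_num.
  rewrite ge0_fin_numE; last by apply: integral_ge0 => t _; rewrite lee_fin trunc_powRN_ge0.
  apply: (@le_lt_trans _ _ (K + K)%:E); last exact: ltry.
  rewrite -(cvg_lim _ cI)//; apply: lime_le; first by apply/cvg_ex; eexists; exact: cI.
  by near=> n; exact: hK.
by exists (fine (\int[mu]_(t in [set: R]) (trunc_powRN th M t)%:E)%E); rewrite fineK.
Unshelve. all: by end_near. Qed.

End powR_integrability.
(** * Calculus *)

Section calculus.
Variable R : realType.

Section pointwise_rules.
Variable V : normedModType R.
Implicit Types (f g : V -> R) (z v : V).

Lemma is_deriveD_fun f g z v (df dg : R) : is_derive z v f df -> is_derive z v g dg ->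
  is_derive z v (fun y => f y + g y) (df + dg).
Proof. exact: is_deriveD. Qed.

Lemma is_deriveM_fun f g z v (df dg : R) : is_derive z v f df -> is_derive z v g dg ->
  is_derive z v (fun y => f y * g y) (df * g z + f z * dg).
Proof.
move=> hf hg; apply: (is_derive_eq (is_deriveM hf hg)).
by rewrite /GRing.scale /= addrC mulrC.
Qed.

Lemma is_deriveZ_fun (c : R) f z v (df : R) : is_derive z v f df ->
  is_derive z v (fun y => c * f y) (c * df).
Proof.
move=> hf; apply: (is_derive_eq (is_deriveM_fun (is_derive_cst c z v) hf)).
by rewrite mul0r add0r.
Qed.

Lemma continuousD_fun f g z : {for z, continuous f} -> {for z, continuous g} ->
  {for z, continuous (fun y => f y + g y)}.
Proof. exact: continuousD. Qed.

Lemma continuousM_fun f g z : {for z, continuous f} -> {for z, continuous g} ->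
  {for z, continuous (fun y => f y * g y)}.
Proof. exact: continuousM. Qed.

Lemma continuous_comp_fun f (h : R -> R) z : {for z, continuous f} ->
  {for f z, continuous h} -> {for z, continuous (fun y => h (f y))}.
Proof. exact: continuous_comp. Qed.

Lemma continuous_near f g z : (\forall y \near z, f y = g y) ->
  {for z, continuous f} -> {for z, continuous g}.
Proof.
move=> fg cf; rewrite /prop_for /continuous_at -(nbhs_singleton fg).
by apply: cvg_trans cf; apply: near_eq_cvg; apply: filterS fg => y ->.
Qed.

End pointwise_rules.

Lemma is_derive1_comp_fun (f g : R -> R) (x df dg : R) :
  is_derive x 1 f df -> is_derive (f x) 1 g dg ->
  is_derive x 1 (fun t => g (f t)) (dg * df).
Proof.
move=> [df1 <-] [dg1 <-].
have d1 : differentiable f x by exact/derivable1_diffP.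
have d2 : differentiable g (f x) by exact/derivable1_diffP.
have d3 : derivable (g \o f) x 1.
  by apply/derivable1_diffP; exact: differentiable_comp d1 d2.
have := derive1_comp df1 dg1; rewrite !derive1E => <-.
exact: DeriveDef.
Qed.

Lemma is_derive_line0 p (f : 'rV[R]_p -> R) (z v : 'rV[R]_p) (d : R) :
  is_derive (0 : R) (1 : R) (fun s : R => f (z + s *: v)) d <-> is_derive z v f d.
Proof. by have := is_derive_line f z v 0 d; rewrite scale0r addr0. Qed.

Lemma is_derive_comp_fun p (f : 'rV[R]_p -> R) (g : R -> R) (z v : 'rV[R]_p) (df dg : R) :
  is_derive z v f df -> is_derive (f z) 1 g dg ->
  is_derive z v (fun y => g (f y)) (dg * df).
Proof.
move=> /is_derive_line0 hf hg; apply/is_derive_line0.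
apply: (is_derive1_comp_fun hf).
by rewrite scale0r addr0.
Qed.

Lemma is_derive_coord p (z : 'rV[R]_p) (i j : 'I_p) :
  is_derive z (delta_mx 0 i : 'rV[R]_p) (fun y => y 0 j) (j == i)%:R.
Proof.
apply/is_derive_line0.
rewrite (_ : (fun _ => _) = (fun s : R => z 0 j + (j == i)%:R * s)); last first.
  by apply/funext => s; rewrite coord_add_delta mulrC.
apply: (is_derive_eq (is_deriveD_fun (is_derive_cst _ _ _) (is_deriveZ_fun _ (is_derive_id _ _)))).
by rewrite add0r mulr1.
Qed.

(** The difference quotient of t g(t) at 0 is g itself, so continuity of g suffices. This settles
    the derivatives at 0 of [ppow] and, where x = 0, of [du]. *)
Lemma is_derive_shift_mul (g : R -> R) : {for 0, continuous g} ->
  is_derive (0 : R) 1 (fun t => g t * t) (g 0).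
Proof.
move=> cg.
have H : (fun h : R => h^-1 *: (((fun t => g t * t) \o shift 0) (h *: (1 : R)) - g 0 * 0))
    @ 0^' --> g 0.
  have : g @ 0^' --> g 0 by apply: cvg_trans cg; apply: cvg_app; exact: cvg_within.
  apply: cvg_trans; apply: near_eq_cvg; near=> h.
  have h0 : h != 0 by near: h; exact: nbhs_dnbhs_neq.
  by rewrite /= mulr0 subr0 addr0 scaler1 /GRing.scale /= mulrC mulfK.
apply: DeriveDef; first by apply/cvg_ex; exists (g 0).
exact/cvg_lim.
Unshelve. all: by end_near. Qed.

(* The power of the positive part: unlike [powR], whose value at negative numbers
   is 1, it is C^1 across 0 for r > 1. *)
Definition ppow (r s : R) : R := if 0 < s then powR s r else 0.

Lemma ppow_ge0 (r s : R) : 0 <= ppow r s.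
Proof. by rewrite /ppow; case: ifPn => // _; exact: powR_ge0. Qed.

Lemma ppow_gt0 (r s : R) : 0 < s -> ppow r s = powR s r.
Proof. by rewrite /ppow => ->. Qed.

Lemma ppow_le0 (r s : R) : s <= 0 -> ppow r s = 0.
Proof. by rewrite /ppow ltNge => ->. Qed.

Lemma ppow_continuous_gt0 (r s : R) : 0 < s -> {for s, continuous (ppow r)}.
Proof.
move=> s0; apply: (@continuous_near _ (fun x => powR x r)); last exact: powR_continuous_gt0.
by near=> x; rewrite ppow_gt0//; near: x; exact: lt_nbhsr.
Unshelve. all: by end_near. Qed.

Lemma ppow_continuous (r : R) : 0 < r -> continuous (ppow r).
Proof.
move=> r0 s; have [s0|s0|->] := ltgtP s 0.
- apply: (@continuous_near _ (fun=> 0)); last exact: cst_continuous.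
  by near=> x; rewrite ppow_le0// ltW//; near: x; exact: lt_nbhsl.
- exact: ppow_continuous_gt0.
- rewrite /continuous_at ppow_le0//; apply/cvgrPdist_lt => e e0.
  near=> x; rewrite sub0r normrN ger0_norm ?ppow_ge0// /ppow; case: ifPn => // x0.
  have -> : e = powR (powR e r^-1) r by rewrite -powRrM mulVf ?gt_eqF// powRr1// ltW.
  rewrite gt0_ltr_powR// ?nnegrE ?powR_ge0// ?ltW//.
  by near: x; apply: lt_nbhsl; rewrite powR_gt0.
Unshelve. all: by end_near. Qed.

Lemma is_derive_ppow_gt0 (r s : R) : 0 < s -> is_derive s 1 (ppow r) (r * ppow (r - 1) s).
Proof.
move=> s0; rewrite ppow_gt0//; apply: (near_eq_is_derive _ (is_derive1_powR r s0)).
by near=> x; rewrite ppow_gt0//; near: x; exact: lt_nbhsr.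
Unshelve. all: by end_near. Qed.

Lemma ppowS (r s : R) : 0 < r -> ppow r s = ppow (r - 1) s * s.
Proof.
move=> r0; rewrite /ppow; case: ifPn => [s0|_]; last by rewrite mul0r.
by rewrite mulrC mulr_powRB1 ?ltW.
Qed.

Lemma is_derive_ppow (r s : R) : 1 < r -> is_derive s 1 (ppow r) (r * ppow (r - 1) s).
Proof.
move=> r1; have [s0|s0|->] := ltgtP s 0.
- rewrite ppow_le0 ?ltW// mulr0; apply: (near_eq_is_derive _ (is_derive_cst 0 s 1)).
  by near=> x; rewrite ppow_le0// ltW//; near: x; exact: lt_nbhsl.
- exact: is_derive_ppow_gt0.
- have -> : ppow r = (fun t => ppow (r - 1) t * t).
    by apply/funext => t; rewrite -ppowS//; lra.
  have -> : r * ppow (r - 1) 0 = ppow (r - 1) 0 by rewrite !ppow_le0// mulr0.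
  by apply: is_derive_shift_mul; apply: ppow_continuous; lra.
Unshelve. all: by end_near. Qed.

Lemma ppow_le (d s t : R) : 0 <= d -> s <= t -> ppow d s <= ppow d t.
Proof.
move=> d0 st; rewrite /ppow; case: ltP => s0; last by case: ifP => // _; exact: powR_ge0.
by rewrite (lt_le_trans s0 st) ge0_ler_powR// nnegrE ltW// (lt_le_trans s0 st).
Qed.

Lemma powR_sum (I : finType) (u : R) (f : I -> R) : 0 < u ->
  powR u (\sum_i f i) = \prod_i powR u (f i).
Proof.
move=> u0; apply: (big_morph (powR u)) => [x y|]; last exact: powRr0.
by rewrite powRD ?(lt0r_neq0 u0) ?implybT.
Qed.

Lemma ler_powRN (x y d : R) : 0 < x -> x <= y -> 0 <= d -> powR y (- d) <= powR x (- d).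
Proof.
move=> x0 xy d0; have y0 := lt_le_trans x0 xy.
by rewrite !powRN lef_pV2 ?posrE ?powR_gt0// ge0_ler_powR// nnegrE ltW.
Qed.

End calculus.
(** * The gauge *)

Section geometry.
Variable R : realType.

Section partial_squares.
Variables (n : nat) (P : pred 'I_n).
Implicit Types z : 'rV[R]_n.

Definition sumsq (z : 'rV[R]_n) : R := \sum_(i < n | P i) z 0 i ^+ 2.

Lemma sumsq_ge0 z : 0 <= sumsq z.
Proof. by apply: sumr_ge0 => i _; exact: sqr_ge0. Qed.

Lemma sqr_le_sumsq z i : P i -> z 0 i ^+ 2 <= sumsq z.
Proof.
by move=> Pi; rewrite /sumsq (bigD1 i)//= lerDl sumr_ge0// => j _; exact: sqr_ge0.
Qed.

Lemma is_derive_sumsq z i :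
  is_derive z (delta_mx 0 i : 'rV[R]_n) sumsq (if P i then 2 * z 0 i else 0).
Proof.
pose h j (y : 'rV[R]_n) : R := if P j then y 0 j * y 0 j else 0.
have -> : sumsq = \sum_(j < n) h j.
  apply/funext => y; rewrite fct_sumE /sumsq big_mkcond /=.
  by apply: eq_bigr => j _; rewrite /h; case: ifP => // _; rewrite expr2.
pose dh j : R := if P j then 2 * z 0 j * (j == i)%:R else 0.
have hdh j : is_derive z (delta_mx 0 i : 'rV[R]_n) (h j) (dh j).
  rewrite /h /dh; case: ifP => _; last exact: is_derive_cst.
  apply: (is_derive_eq (is_deriveM_fun (is_derive_coord z i j) (is_derive_coord z i j))).
  ring.
apply: (is_derive_eq (is_derive_sum hdh)).
rewrite (bigD1 i)//= big1 ?addr0 /dh ?eqxx ?mulr1// => j ji.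
by rewrite (negbTE ji) mulr0; case: ifP.
Qed.

Lemma coord_cont (i : 'I_n) z : {for z, continuous (fun y : 'rV[R]_n => y 0 i)}.
Proof. exact: coord_continuous. Qed.

Lemma sumsq_continuous z : {for z, continuous sumsq}.
Proof.
suff : continuous sumsq by apply.
apply: continuous_big => [|i _]; first exact: add_continuous.
have sqr_cont (y : 'rV[R]_n) : {for y, continuous (fun y : 'rV[R]_n => y 0 i ^+ 2)}.
  rewrite (_ : (fun _ => _) = (fun y : 'rV[R]_n => y 0 i * y 0 i)); last first.
    by apply/funext => ?; rewrite expr2.
  by apply: continuousM_fun; exact: coord_cont.
exact: sqr_cont.
Qed.

Lemma sumsq_line z i (s : R) : ~~ P i -> sumsq (z + s *: delta_mx 0 i) = sumsq z.
Proof.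
move=> Pi; apply: eq_bigr => j Pj; rewrite coord_add_delta; case: eqP => [ji|_].
  by rewrite -ji Pj in Pi.
by rewrite mulr0 addr0.
Qed.

End partial_squares.

Variables (m k : nat) (g : R).
Hypothesis g0 : 0 < g.
Notation n := (m + k)%N.
Implicit Types (z : 'rV[R]_n) (i : 'I_n).

(* sqx = |x|^2, sqy = |y|^2, wx = |x|^(2 gamma) and ug = rho^(2 (1 + gamma));
   [wt i] is the coefficient of the i-th second derivative in the Grushin operator,
   [du] and [ddu] are the pure first and second derivatives of [ug]. *)
Definition sqx z := sumsq (fun i : 'I_n => (i < m)%N) z.
Definition sqy z := sumsq (fun i : 'I_n => (m <= i)%N) z.
Definition wx z := ppow g (sqx z).
Definition ug z := ppow (1 + g) (sqx z) + (1 + g) ^+ 2 * sqy z.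
Definition wt i : 'rV[R]_n -> R := if (i < m)%N then fun=> 1 else wx.
Definition du i : 'rV[R]_n -> R :=
  if (i < m)%N then fun z => 2 * (1 + g) * (wx z * z 0 i)
  else fun z => 2 * (1 + g) ^+ 2 * z 0 i.
Definition ddu i : 'rV[R]_n -> R :=
  if (i < m)%N
  then fun z => 2 * (1 + g) * (wx z + 2 * g * (z 0 i ^+ 2 * ppow (g - 1) (sqx z)))
  else fun=> 2 * (1 + g) ^+ 2.

Lemma ug_ge0 z : 0 <= ug z.
Proof. by rewrite addr_ge0 ?ppow_ge0// mulr_ge0 ?sqr_ge0// sumsq_ge0. Qed.

Lemma wt_ge0 i z : 0 <= wt i z.
Proof. by rewrite /wt; case: ifP => // _; exact: ppow_ge0. Qed.

Lemma wx_continuous z : {for z, continuous wx}.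
Proof.
by rewrite /wx; apply: continuous_comp_fun; [exact: sumsq_continuous|exact: ppow_continuous].
Qed.

Lemma ug_continuous z : {for z, continuous ug}.
Proof.
have g1 : 0 < 1 + g by rewrite addr_gt0.
rewrite /ug; apply: continuousD_fun.
  by apply: continuous_comp_fun; [exact: sumsq_continuous|exact: ppow_continuous].
by apply: continuousM_fun; [exact: cst_continuous|exact: sumsq_continuous].
Qed.

Lemma wt_continuous i z : {for z, continuous (wt i)}.
Proof.
by rewrite /wt; case: ifP => _; [exact: cst_continuous|exact: wx_continuous].
Qed.

Lemma du_continuous i z : {for z, continuous (du i)}.
Proof.
rewrite /du; case: ifP => _; (apply: continuousM_fun; first exact: cst_continuous).
  by apply: continuousM_fun; [exact: wx_continuous|exact: coord_cont].
exact: coord_cont.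
Qed.

(** Only x = 0 is delicate, since the exponent g - 1 may be negative: there the term z_i^2 |x|^(2 (g
    - 1)) is squeezed between 0 and [wx], which tends to 0. *)
Lemma ddu_continuous i z : {for z, continuous (ddu i)}.
Proof.
rewrite /ddu; case: ifP => im; last exact: cst_continuous.
apply: continuousM_fun; first exact: cst_continuous.
apply: continuousD_fun; first exact: wx_continuous.
apply: continuousM_fun; first exact: cst_continuous.
have := sumsq_ge0 (fun i : 'I_n => (i < m)%N) z; rewrite -/(sqx z) le_eqVlt => /predU1P[S0|S0].
  rewrite /prop_for /continuous_at -S0 (ppow_le0 (g - 1) (lexx 0)) mulr0.
  have wx0 : wx y @[y --> z] --> (0 : R).
    by have := @wx_continuous z; rewrite /prop_for /continuous_at {2}/wx -S0 ppow_le0.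
  apply: (squeeze_cvgr _ (cvg_cst (0 : R)) wx0).
  near=> y; rewrite mulr_ge0 ?sqr_ge0 ?ppow_ge0//= /wx (ppowS _ g0) mulrC.
  by rewrite ler_wpM2l ?ppow_ge0// sqr_le_sumsq.
apply: continuousM_fun; last first.
  by apply: continuous_comp_fun; [exact: sumsq_continuous|exact: ppow_continuous_gt0].
rewrite (_ : (fun _ => _) = (fun y : 'rV[R]_n => y 0 i * y 0 i)); last first.
  by apply/funext => y; rewrite expr2.
by apply: continuousM_fun; exact: coord_cont.
Unshelve. all: by end_near. Qed.

Lemma is_derive_ug i z : is_derive z (delta_mx 0 i : 'rV[R]_n) ug (du i z).
Proof.
have dx := is_derive_sumsq (fun i : 'I_n => (i < m)%N) z i.
have dy := is_derive_sumsq (fun i : 'I_n => (m <= i)%N) z i.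
have g1 : 1 < 1 + g by rewrite ltrDl.
apply: (is_derive_eq (is_deriveD_fun (is_derive_comp_fun dx (is_derive_ppow _ g1))
   (is_deriveZ_fun _ dy))).
rewrite /du [(m <= i)%N]leqNgt; case: ifP => im /=.
  rewrite -/(sqx z) (_ : 1 + g - 1 = g); last by rewrite addrAC subrr add0r.
 by rewrite -/(wx z); ring.
by rewrite mulr0 add0r; ring.
Qed.

(** The weight of an x-direction is constant, and that of a y-direction depends on x only. *)
Lemma is_derive_wt i z : is_derive z (delta_mx 0 i : 'rV[R]_n) (wt i) 0.
Proof.
rewrite /wt; case: ifP => im; first exact: is_derive_cst.
apply/is_derive_line0.
rewrite (_ : (fun _ => _) = (fun=> wx z)); first exact: is_derive_cst.
by apply/funext => s; rewrite /wx /sqx sumsq_line//= im.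
Qed.

Lemma is_derive_du i z : is_derive z (delta_mx 0 i : 'rV[R]_n) (du i) (ddu i z).
Proof.
rewrite /du /ddu; case: ifP => im; last first.
  apply: (is_derive_eq (is_deriveZ_fun _ (is_derive_coord z i i))).
  by rewrite eqxx mulr1.
apply: is_deriveZ_fun.
have := sumsq_ge0 (fun i : 'I_n => (i < m)%N) z; rewrite -/(sqx z) le_eqVlt => /predU1P[S0|S0].
  have z0 : z 0 i = 0.
    apply/eqP; rewrite -sqrf_eq0 eq_le sqr_ge0 andbT S0.
    exact: (sqr_le_sumsq (P := fun i : 'I_n => (i < m)%N)).
  rewrite z0 expr0n /= mul0r mulr0 addr0; apply/is_derive_line0.
  rewrite (_ : (fun _ => _) = (fun s : R => wx (z + s *: delta_mx 0 i) * s)); last first.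
    by apply/funext => s; rewrite coord_add_delta eqxx mulr1 z0 add0r.
  rewrite -[X in is_derive _ _ _ (wx X)]addr0
    -[X in is_derive _ _ _ (wx (_ + X))](scale0r (delta_mx 0 i)).
  apply: (is_derive_shift_mul (g := fun s : R => wx (z + s *: delta_mx 0 i))).
  apply: (@continuous_comp _ _ _ (fun s : R => z + s *: delta_mx 0 i) wx).
    apply: (@continuousD _ _ _ (fun=> z) (fun s : R => s *: (delta_mx 0 i : 'rV[R]_n))).
      exact: cst_continuous.
    exact: scalel_continuous.
  exact: wx_continuous.
have dx := is_derive_sumsq (fun i : 'I_n => (i < m)%N) z i.
apply: (is_derive_eq (is_deriveM_fun (is_derive_comp_fun dx (is_derive_ppow_gt0 g S0))
  (is_derive_coord z i i))).
by rewrite im eqxx /= -/(sqx z) /wx; ring.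
Qed.

Lemma sum_split (F : 'I_n -> R) :
  \sum_i F i = \sum_(i < n | (i < m)%N) F i + \sum_(i < n | (m <= i)%N) F i.
Proof.
rewrite (bigID (fun i : 'I_n => (i < m)%N)) /=; congr (_ + _).
by apply: eq_bigl => i; rewrite -leqNgt.
Qed.

(** This is the squared Grushin gradient of u; the x-part and y-part recombine into u because |x|^(2
    (1 + g)) = [wx] |x|^2. *)
Lemma sum_gamma_u z : \sum_i wt i z * du i z ^+ 2 = (2 * (1 + g)) ^+ 2 * wx z * ug z.
Proof.
rewrite sum_split.
rewrite (eq_bigr (fun i : 'I_n => (2 * (1 + g) * wx z) ^+ 2 * z 0 i ^+ 2)); last first.
  by move=> i im; rewrite /wt /du im; ring.
rewrite [X in _ + X](eq_bigr (fun i : 'I_n => wx z * (2 * (1 + g) ^+ 2) ^+ 2 * z 0 i ^+ 2)); last first.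
  by move=> i im; rewrite /wt /du ltnNge im /=; ring.
rewrite -!mulr_sumr -/(sqx z) -/(sqy z) /ug ppowS; last by rewrite addr_gt0.
rewrite -/(sqx z) -/(sqy z) (_ : 1 + g - 1 = g); last by ring.
by rewrite -/(wx z) /sqx /sqy /sumsq; ring.
Qed.

(** This is the Grushin operator applied to u; counting the m directions in x and the k directions
    in y produces m + (1 + g) k = Q. *)
Lemma sum_lap_u z :
  \sum_i wt i z * ddu i z = 2 * (1 + g) * (homdim m k g + 2 * g) * wx z.
Proof.
rewrite sum_split.
rewrite (eq_bigr (fun i : 'I_n => 2 * (1 + g) * wx z +
  4 * (1 + g) * g * ppow (g - 1) (sqx z) * z 0 i ^+ 2)); last first.
  by move=> i im; rewrite /wt /ddu im; ring.
rewrite [X in _ + X](eq_bigr (fun i : 'I_n => wx z * (2 * (1 + g) ^+ 2))); last first.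
  by move=> i im; rewrite /wt /ddu ltnNge im.
rewrite big_split /= !sumr_const.
have -> : #|[pred i : 'I_n | (i < m)%N]| = m.
  rewrite -sum1_card big_split_ord /= [X in (_ + X)%N]big1 ?addn0.
    by rewrite (eq_bigl xpredT) ?sum1_card ?card_ord// => i; rewrite inE /= ltn_ord.
  by move=> i; rewrite inE /= ltnNge leq_addr.
have -> : #|[pred i : 'I_n | (m <= i)%N]| = k.
  rewrite -sum1_card big_split_ord /= [X in (X + _)%N]big1 ?add0n.
    by rewrite (eq_bigl xpredT) ?sum1_card ?card_ord// => i; rewrite inE /= leq_addr.
  by move=> i; rewrite inE /= leqNgt ltn_ord.
rewrite -[_ *+ m]mulr_natr -[_ *+ k]mulr_natr /homdim.
have E : wx z = ppow (g - 1) (sqx z) * sqx z by rewrite /wx (ppowS _ g0).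
have -> : \sum_(i < n | (i < m)%N)
    4 * (1 + g) * g * ppow (g - 1) (sqx z) * z 0 i ^+ 2 = 4 * (1 + g) * g * wx z.
  by rewrite -mulr_sumr -/(sumsq (fun i : 'I_n => (i < m)%N) z) -/(sqx z) E !mulrA.
ring.
Qed.

End geometry.
(** * The vector field *)

Section divergence_field.
Variables (R : realType) (m k : nat) (g : R).
Hypothesis g0 : 0 < g.
Notation n := (m + k)%N.
Implicit Types (z : 'rV[R]_n) (i : 'I_n).
Variables (R0 e : R) (phi : 'rV[R]_n -> R).
Hypothesis e0 : 0 < e.
Hypothesis smooth_phi : smooth phi.
Hypothesis compact_phi : compact (supp phi).
Hypothesis supp_phi : supp phi `<=` [set z | ug g z < R0].

Definition dphi i := partial i phi.
Definition ddphi i := partial i (partial i phi).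

Lemma phi_continuous z : {for z, continuous phi}.
Proof. by have [c _] := smooth_phi [::]; exact: c. Qed.

Lemma dphi_continuous i z : {for z, continuous (dphi i)}.
Proof. by have [c _] := smooth_phi [:: i]; exact: c. Qed.

Lemma ddphi_continuous i z : {for z, continuous (ddphi i)}.
Proof. by have [c _] := smooth_phi [:: i; i]; exact: c. Qed.

Lemma is_derive_phi i z : is_derive z (delta_mx 0 i : 'rV[R]_n) phi (dphi i z).
Proof. by have [_ d] := smooth_phi [::]; apply: DeriveDef => //; exact: d. Qed.

Lemma is_derive_dphi i z : is_derive z (delta_mx 0 i : 'rV[R]_n) (dphi i) (ddphi i z).
Proof. by have [_ d] := smooth_phi [:: i]; apply: DeriveDef => //; exact: d. Qed.

Lemma near_nsupp z : ~ supp phi z -> \forall y \near z, ~ supp phi y.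
Proof.
move=> nz; apply: (@open_nbhs_nbhs _ z (~` supp phi)); split => //.
by apply: closed_openC; exact: closed_closure.
Qed.

Lemma phi_nsupp z : ~ supp phi z -> phi z = 0.
Proof.
move=> nz; apply/eqP; apply: contrapT => /negP h; apply: nz.
exact: subset_closure.
Qed.

Lemma dphi_nsupp i z : ~ supp phi z -> dphi i z = 0.
Proof.
move=> /near_nsupp nz; rewrite /dphi /partial (near_eq_derive (g := cst 0)).
  exact: derive_cst.
by apply: filterS nz => y; exact: phi_nsupp.
Qed.

Lemma supp_phi_box : exists M : R, forall z, (exists i, M < `|z 0 i|) -> ~ supp phi z.
Proof.
have [M [_ HM]] := compact_bounded compact_phi.
exists (M + 1) => z [i zi] sz; have := HM (M + 1) _ z sz.
rewrite ltrDl ltr01 => /(_ isT) /= zM.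
have zin : `|z 0 i| <= `|z|.
  rewrite [leRHS]/Num.norm /= mx_normrE.
  by apply/bigmax_geP; right => /=; exists (0, i).
by have := lt_le_trans zi (le_trans zin zM); rewrite ltxx.
Qed.

(** F vanishes on the open sets off the support of phi and where u < e, so continuity is only at
    stake where 0 < u < R0, the range in which the radial weights are regular. *)
Lemma ucs_cases (F : 'rV[R]_n -> R) :
  (forall z, 0 < ug g z -> ug g z < R0 -> {for z, continuous F}) ->
  (forall z, ~ supp phi z -> F z = 0) -> (forall z, ug g z < e -> F z = 0) -> ucs F.
Proof.
move=> Fc Fs Fe; have [M HM] := supp_phi_box.
apply: (@continuous_ucs _ _ _ M); last by move=> z /HM; exact: Fs.
suff H z : {for z, continuous F} by exact: H.
have [sz|nz] := pselect (supp phi z); last first.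
  apply: (@continuous_near _ _ (fun=> 0)); last exact: cst_continuous.
  by apply: filterS (near_nsupp nz) => y /Fs.
have [ze|ez] := ltP (ug g z) e; last first.
  by apply: Fc; [exact: lt_le_trans ez|exact: supp_phi].
apply: (@continuous_near _ _ (fun=> 0)); last exact: cst_continuous.
have : \forall y \near z, ug g y < e.
  exact: (@ug_continuous R m k g g0 z _ (lt_nbhsl ze)).
by apply: filterS => y /Fe.
Qed.

Lemma ucs_weight (K : R -> R) :
  (forall u : R, 0 < u -> u < R0 -> {for u, continuous K}) ->
  (forall u : R, 0 <= u -> u < e -> K u = 0) ->
  ucs (fun z => phi z * phi z * (wx g z * K (ug g z))).
Proof.
move=> cK K0; apply: ucs_cases.
- move=> z u0 u1.
  apply: continuousM_fun; first by apply: continuousM_fun; exact: phi_continuous.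
  apply: continuousM_fun; first exact: wx_continuous.
  by apply: continuous_comp_fun; [exact: ug_continuous|exact: cK].
- by move=> z /phi_nsupp ->; rewrite !mul0r.
- by move=> z ze; rewrite K0 ?ug_ge0// !mulr0.
Qed.

(* All radial functions are functions of u = ug z; W1 and H1 are the derivatives of
   W and H. *)
Variables W H W1 H1 : R -> R.
Hypothesis dW : forall u : R, 0 < u -> u < R0 -> is_derive u 1 W (W1 u).
Hypothesis dH : forall u : R, 0 < u -> u < R0 -> is_derive u 1 H (H1 u).
Hypothesis cW1 : forall u : R, 0 < u -> u < R0 -> {for u, continuous W1}.
Hypothesis cH1 : forall u : R, 0 < u -> u < R0 -> {for u, continuous H1}.
Hypothesis WH0 : forall u : R, 0 <= u -> u < e -> [/\ W u = 0, H u = 0, W1 u = 0 & H1 u = 0].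

(** Component i of - W phi grad phi + 1/2 H phi^2 grad u; the factor [wt i] turns the Euclidean
    divergence into the Grushin one, and H grad u stands for (2 W h + W') grad rho. *)
Definition vfield i z := wt g i z * (- 1 * (W (ug g z) * (phi z * dphi i z)) +
  2^-1 * (phi z * phi z * (H (ug g z) * du g i z))).

Definition dvfield i z := wt g i z *
  (- 1 * (W1 (ug g z) * du g i z * (phi z * dphi i z) +
          W (ug g z) * (dphi i z * dphi i z + phi z * ddphi i z)) +
  2^-1 * ((dphi i z * phi z + phi z * dphi i z) * (H (ug g z) * du g i z) +
     phi z * phi z * (H1 (ug g z) * du g i z * du g i z + H (ug g z) * ddu g i z))).

Lemma is_derive_continuous (F : R -> R) u d : is_derive u (1 : R) F d -> {for u, continuous F}.
Proof.
by move=> [dF _]; apply: differentiable_continuous; exact/derivable1_diffP.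
Qed.

Lemma vfield_ucs i : ucs (vfield i).
Proof.
apply: ucs_cases.
- move=> z u0 u1; rewrite /vfield.
  have cW := is_derive_continuous (dW u0 u1); have cH := is_derive_continuous (dH u0 u1).
  have cu := ug_continuous g0 (z := z); have cp := @phi_continuous z.
  have cd := @dphi_continuous i z; have cdu := du_continuous g0 (i := i) (z := z).
  have cw := wt_continuous g0 (i := i) (z := z).
  have cWu : {for z, continuous (fun y => W (ug g y))} := continuous_comp_fun cu cW.
  have cHu : {for z, continuous (fun y => H (ug g y))} := continuous_comp_fun cu cH.
  have c1 : {for z, continuous (fun y : 'rV[R]_n => - 1 : R)} by exact: cst_continuous.
  have c2 : {for z, continuous (fun y : 'rV[R]_n => 2^-1 : R)} by exact: cst_continuous.
  exact: (continuousM_fun cw (continuousD_fun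
    (continuousM_fun c1 (continuousM_fun cWu (continuousM_fun cp cd)))
    (continuousM_fun c2 (continuousM_fun (continuousM_fun cp cp) (continuousM_fun cHu cdu))))).
- by move=> z nz; rewrite /vfield phi_nsupp// dphi_nsupp//; ring.
- by move=> z ze; have [Wz Hz _ _] := WH0 (ug_ge0 g z) ze; rewrite /vfield Wz Hz; ring.
Qed.

Lemma dvfield_ucs i : ucs (dvfield i).
Proof.
apply: ucs_cases.
- move=> z u0 u1; rewrite /dvfield.
  have cW := is_derive_continuous (dW u0 u1); have cH := is_derive_continuous (dH u0 u1).
  have cW1z := cW1 u0 u1; have cH1z := cH1 u0 u1.
  have cu := ug_continuous g0 (z := z); have cp := @phi_continuous z.
  have cd := @dphi_continuous i z; have cdd := @ddphi_continuous i z.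
  have cdu := du_continuous g0 (i := i) (z := z).
  have cddu := ddu_continuous g0 (i := i) (z := z).
  have cw := wt_continuous g0 (i := i) (z := z).
  have cWu : {for z, continuous (fun y => W (ug g y))} := continuous_comp_fun cu cW.
  have cHu : {for z, continuous (fun y => H (ug g y))} := continuous_comp_fun cu cH.
  have cW1u : {for z, continuous (fun y => W1 (ug g y))} := continuous_comp_fun cu cW1z.
  have cH1u : {for z, continuous (fun y => H1 (ug g y))} := continuous_comp_fun cu cH1z.
  have c1 : {for z, continuous (fun y : 'rV[R]_n => - 1 : R)} by exact: cst_continuous.
  have c2 : {for z, continuous (fun y : 'rV[R]_n => 2^-1 : R)} by exact: cst_continuous.
  exact: (continuousM_fun cw (continuousD_fun
    (continuousM_fun c1 (continuousD_fun
       (continuousM_fun (continuousM_fun cW1u cdu) (continuousM_fun cp cd))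
       (continuousM_fun cWu (continuousD_fun (continuousM_fun cd cd) (continuousM_fun cp cdd)))))
    (continuousM_fun c2 (continuousD_fun
       (continuousM_fun (continuousD_fun (continuousM_fun cd cp) (continuousM_fun cp cd))
          (continuousM_fun cHu cdu))
       (continuousM_fun (continuousM_fun cp cp) (continuousD_fun
          (continuousM_fun (continuousM_fun cH1u cdu) cdu) (continuousM_fun cHu cddu))))))).
- by move=> z nz; rewrite /dvfield phi_nsupp// dphi_nsupp//; ring.
- by move=> z ze; have [Wz Hz W1z H1z] := WH0 (ug_ge0 g z) ze; rewrite /dvfield Wz Hz W1z H1z; ring.
Qed.

(** Off the support and where u < e the field is locally zero; elsewhere the product and chain rules
    apply. *)
Lemma is_derive_vfield i z : is_derive z (delta_mx 0 i : 'rV[R]_n) (vfield i) (dvfield i z).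
Proof.
have V0 y : (~ supp phi y) \/ ug g y < e -> vfield i y = 0.
  move=> [ny|ye]; first by rewrite /vfield phi_nsupp//; ring.
  by have [Wz Hz _ _] := WH0 (ug_ge0 g y) ye; rewrite /vfield Wz Hz; ring.
have [sz|nz] := pselect (supp phi z); last first.
  have -> : dvfield i z = 0 by rewrite /dvfield phi_nsupp// dphi_nsupp//; ring.
  apply: near_eq_is_derive (is_derive_cst 0 _ _).
  by apply: filterS (near_nsupp nz) => y ny; rewrite V0//; left.
have [ze|ez] := ltP (ug g z) e.
  have -> : dvfield i z = 0.
    by have [Wz Hz W1z H1z] := WH0 (ug_ge0 g z) ze; rewrite /dvfield Wz Hz W1z H1z; ring.
  apply: near_eq_is_derive (is_derive_cst 0 _ _).
  have : \forall y \near z, ug g y < e.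
    exact: (@ug_continuous R m k g g0 z _ (lt_nbhsl ze)).
  by apply: filterS => y ye; rewrite V0//; right.
have u0 : 0 < ug g z by exact: lt_le_trans ez.
have u1 : ug g z < R0 by exact: supp_phi.
have dWu := is_derive_comp_fun (is_derive_ug g0 i z) (dW u0 u1).
have dHu := is_derive_comp_fun (is_derive_ug g0 i z) (dH u0 u1).
have dp := is_derive_phi i z; have ddp := is_derive_dphi i z.
have dX := is_deriveD_fun
  (is_deriveZ_fun (- 1) (is_deriveM_fun dWu (is_deriveM_fun dp ddp)))
  (is_deriveZ_fun 2^-1 (is_deriveM_fun (is_deriveM_fun dp dp)
     (is_deriveM_fun dHu (is_derive_du g0 i z)))).
apply: (is_derive_eq (is_deriveM_fun (is_derive_wt g i z) dX)).
by rewrite /dvfield; ring.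
Qed.

Lemma Iint_sum0 (F : 'I_n -> 'rV[R]_n -> R) : (forall i, ucs (F i) /\ Iint (F i) = 0) ->
  ucs (fun z => \sum_i F i z) /\ Iint (fun z => \sum_i F i z) = 0.
Proof.
move=> FP; rewrite (_ : (fun z => _) = \sum_i F i); last first.
  by apply/funext => z; rewrite fct_sumE.
apply: (big_ind (fun f : 'rV[R]_n -> R => ucs f /\ Iint f = 0)) => //.
  by split; [exact: ucs0|exact: Iint0].
move=> f h [uf If] [uh Ih].
have -> : f + h = (fun z => 1 * f z + h z) by apply/funext => z; rewrite mul1r.
by split; [exact: ucs_lin|rewrite Iint_lin// If Ih mulr0 addr0].
Qed.

Lemma div_vfield : ucs (fun z => \sum_i dvfield i z) /\ Iint (fun z => \sum_i dvfield i z) = 0.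
Proof.
apply: Iint_sum0 => i; split; first exact: dvfield_ucs.
by apply: Iint_div (vfield_ucs i) (dvfield_ucs i) (is_derive_vfield i).
Qed.

End divergence_field.
(** * The radial weights *)

Section radial_weights.
Variables (R : realType) (a b c0 k1 lr e : R).
Hypothesis e0 : 0 < e.
Implicit Types u : R.

(* In terms of u = rho^a with a = 2 (1 + gamma), b = (alpha - 2) / a and lr = a ln r:
   [lnw u] = a ln (r / rho), [Wr] = c0 rho^(alpha - 2) chi_e, and [hr], [Hr] are such
   that h grad rho = hr grad u and (2 W h + W') grad rho = Hr grad u.
   At u = 0 the cutoff is (0 - e) / 0 = 0, so the weights vanish on all of [0, e). *)
Definition cutoff u : R := (u - e) / u.
Definition lnw u : R := lr - ln u.
Definition Wr u := c0 * (powR u b * ppow 3 (cutoff u)).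
Definition Wr1 u := c0 * (b * powR u (b - 1) * ppow 3 (cutoff u) +
  powR u b * (3 * ppow 2 (cutoff u) * (e * (u^-1 * u^-1)))).
Definition Er u := (k1 + - 1 * (lnw u)^-1) * ppow 3 (cutoff u) +
  3 * ppow 2 (cutoff u) * (e * u^-1).
Definition Hr u := c0 * (powR u (b - 1) * Er u).
Definition Hr1 u := c0 * ((b - 1) * powR u (b - 2) * Er u + powR u (b - 1) *
  (- 1 * ((lnw u)^-1 * (lnw u)^-1 * u^-1) * ppow 3 (cutoff u) +
   (k1 + - 1 * (lnw u)^-1) * (3 * ppow 2 (cutoff u) * (e * (u^-1 * u^-1))) +
   (3 * (2 * ppow 1 (cutoff u) * (e * (u^-1 * u^-1))) * (e * u^-1) +
    3 * ppow 2 (cutoff u) * (e * (- 1 * (u^-1 * u^-1)))))).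

Lemma cutoff_le0 u : 0 <= u -> u < e -> cutoff u <= 0.
Proof.
by move=> u0 ue; rewrite /cutoff mulr_le0_ge0// ?invr_ge0// subr_le0 ltW.
Qed.

Lemma cutoffE u : 0 < u -> cutoff u = 1 - e / u.
Proof. by move=> u0; rewrite /cutoff mulrBl divff// gt_eqF. Qed.

Lemma WHr0 u : 0 <= u -> u < e -> [/\ Wr u = 0, Hr u = 0, Wr1 u = 0 & Hr1 u = 0].
Proof.
move=> u0 ue; have q0 := cutoff_le0 u0 ue.
by rewrite /Wr /Hr /Wr1 /Hr1 /Er !(ppow_le0 _ q0); split; ring.
Qed.

Lemma is_derive_inv u : 0 < u -> is_derive u (1 : R) (fun x => x^-1) (- 1 * (u^-1 * u^-1)).
Proof.
move=> u0; have un0 : u != 0 by rewrite gt_eqF.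
apply: (is_derive_eq (is_deriveV un0 (is_derive_id u 1))).
by rewrite /GRing.scale /= mulr1 mulN1r expr2 invfM.
Qed.

Lemma is_derive_cutoff u : 0 < u -> is_derive u (1 : R) cutoff (e * (u^-1 * u^-1)).
Proof.
move=> u0.
have d1 : is_derive u (1 : R) (fun x => x + - e) (1 + 0).
  exact: (is_deriveD_fun (is_derive_id u 1) (is_derive_cst (- e) u 1)).
apply: (is_derive_eq (is_deriveM_fun d1 (is_derive_inv u0))).
by field; rewrite gt_eqF.
Qed.

Lemma is_derive_lnwV u : 0 < u -> lnw u != 0 ->
  is_derive u (1 : R) (fun x => (lnw x)^-1) ((lnw u)^-1 * (lnw u)^-1 * u^-1).
Proof.
move=> u0 l0.
have d1 : is_derive u (1 : R) lnw (0 + - 1 * u^-1).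
  rewrite (_ : lnw = fun x => lr + - 1 * ln x); last first.
    by apply/funext => x; rewrite mulN1r.
  exact: (is_deriveD_fun (is_derive_cst lr u 1) (is_deriveZ_fun (- 1) (is_derive1_ln u0))).
apply: (is_derive_eq (is_deriveV l0 d1)).
by rewrite /GRing.scale /= expr2 invfM; ring.
Qed.

Lemma is_derive_ppow_cutoff (d : R) u : 1 < d -> 0 < u ->
  is_derive u (1 : R) (fun x => ppow d (cutoff x))
    (d * ppow (d - 1) (cutoff u) * (e * (u^-1 * u^-1))).
Proof.
by move=> d1 u0; exact: (is_derive1_comp_fun (is_derive_cutoff u0) (is_derive_ppow _ d1)).
Qed.

Lemma is_derive_ppow3 u : 0 < u -> is_derive u (1 : R) (fun x => ppow 3 (cutoff x))
    (3 * ppow 2 (cutoff u) * (e * (u^-1 * u^-1))).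
Proof.
move=> u0; have d1 : (1 : R) < 3 by lra.
by have := is_derive_ppow_cutoff d1 u0; rewrite (_ : 3 - 1 = 2 :> R)//; ring.
Qed.

Lemma is_derive_ppow2 u : 0 < u -> is_derive u (1 : R) (fun x => ppow 2 (cutoff x))
    (2 * ppow 1 (cutoff u) * (e * (u^-1 * u^-1))).
Proof.
move=> u0; have d1 : (1 : R) < 2 by lra.
by have := is_derive_ppow_cutoff d1 u0; rewrite (_ : 2 - 1 = 1 :> R)//; ring.
Qed.

Lemma is_derive_Wr u : 0 < u -> is_derive u (1 : R) Wr (Wr1 u).
Proof.
move=> u0.
exact: (is_deriveZ_fun c0 (is_deriveM_fun (is_derive1_powR b u0) (is_derive_ppow3 u0))).
Qed.

Lemma is_derive_Er u : 0 < u -> lnw u != 0 -> is_derive u (1 : R) Er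
  (- 1 * ((lnw u)^-1 * (lnw u)^-1 * u^-1) * ppow 3 (cutoff u) +
   (k1 + - 1 * (lnw u)^-1) * (3 * ppow 2 (cutoff u) * (e * (u^-1 * u^-1))) +
   (3 * (2 * ppow 1 (cutoff u) * (e * (u^-1 * u^-1))) * (e * u^-1) +
    3 * ppow 2 (cutoff u) * (e * (- 1 * (u^-1 * u^-1))))).
Proof.
move=> u0 l0.
have d1 := is_deriveD_fun (is_derive_cst k1 u (1 : R))
  (is_deriveZ_fun (- 1) (is_derive_lnwV u0 l0)).
apply: (is_derive_eq (is_deriveD_fun (is_deriveM_fun d1 (is_derive_ppow3 u0))
  (is_deriveM_fun (is_deriveZ_fun 3 (is_derive_ppow2 u0))
     (is_deriveZ_fun e (is_derive_inv u0))))).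
by rewrite add0r.
Qed.

Lemma is_derive_Hr u : 0 < u -> lnw u != 0 -> is_derive u (1 : R) Hr (Hr1 u).
Proof.
move=> u0 l0.
have := is_deriveZ_fun c0 (is_deriveM_fun (is_derive1_powR (b - 1) u0) (is_derive_Er u0 l0)).
by rewrite (_ : b - 1 - 1 = b - 2)//; ring.
Qed.

Section continuity.
Variable u : R.
Hypotheses (u0 : 0 < u) (l0 : lnw u != 0).

Let cinv : {for u, continuous (fun x : R => x^-1)} := is_derive_continuous (is_derive_inv u0).
Let clV : {for u, continuous (fun x : R => (lnw x)^-1)} :=
  is_derive_continuous (is_derive_lnwV u0 l0).
Let cp3 : {for u, continuous (fun x : R => ppow 3 (cutoff x))} :=
  is_derive_continuous (is_derive_ppow3 u0).
Let cp2 : {for u, continuous (fun x : R => ppow 2 (cutoff x))} :=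
  is_derive_continuous (is_derive_ppow2 u0).
Let cc (c : R) : {for u, continuous (fun _ : R => c)} := @cst_continuous _ _ c u.
Let cE : {for u, continuous Er} := is_derive_continuous (is_derive_Er u0 l0).
Let cii := continuousM_fun cinv cinv.
Let cpow (d : R) : {for u, continuous (fun x : R => powR x d)} := powR_continuous_gt0 u0.

Lemma ppow1_cutoff_continuous : {for u, continuous (fun x : R => ppow 1 (cutoff x))}.
Proof.
have cq := is_derive_continuous (is_derive_cutoff u0).
by apply: (continuous_comp_fun cq); apply: ppow_continuous.
Qed.

Let cp1 := ppow1_cutoff_continuous.

Lemma Wr1_continuous : {for u, continuous Wr1}.
Proof.
rewrite /Wr1.
exact: (continuousM_fun (@cc c0) (continuousD_fun
  (continuousM_fun (continuousM_fun (@cc b) (@cpow (b - 1))) cp3)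
  (continuousM_fun (@cpow b) (continuousM_fun (continuousM_fun (@cc 3) cp2)
     (continuousM_fun (@cc e) cii))))).
Qed.

Lemma Hr1_continuous : {for u, continuous Hr1}.
Proof.
rewrite /Hr1.
exact: (continuousM_fun (@cc c0) (continuousD_fun
  (continuousM_fun (continuousM_fun (@cc (b - 1)) (@cpow (b - 2))) cE)
  (continuousM_fun (@cpow (b - 1)) (continuousD_fun
    (continuousD_fun
      (continuousM_fun (continuousM_fun (@cc (- 1))
          (continuousM_fun (continuousM_fun clV clV) cinv)) cp3)
      (continuousM_fun (continuousD_fun (@cc k1) (continuousM_fun (@cc (- 1)) clV))
          (continuousM_fun (continuousM_fun (@cc 3) cp2) (continuousM_fun (@cc e) cii))))
    (continuousD_fun
      (continuousM_fun (continuousM_fun (@cc 3) (continuousM_fun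
          (continuousM_fun (@cc 2) cp1) (continuousM_fun (@cc e) cii)))
        (continuousM_fun (@cc e) cinv))
      (continuousM_fun (continuousM_fun (@cc 3) cp2) (continuousM_fun (@cc e)
        (continuousM_fun (@cc (- 1)) cii)))))))).
Qed.

Lemma main_weight_continuous : {for u, continuous (fun x => powR x (b - 1) * ppow 3 (cutoff x))}.
Proof. exact: (continuousM_fun (@cpow (b - 1)) cp3). Qed.

Lemma log_weight_continuous : {for u, continuous (fun x =>
  powR x (b - 1) * ppow 3 (cutoff x) * ((lnw x)^-1 * (lnw x)^-1))}.
Proof. exact: (continuousM_fun main_weight_continuous (continuousM_fun clV clV)). Qed.

Lemma error_weight_continuous : {for u, continuous (fun x =>
  powR x (b - 1) * (ppow 1 (cutoff x) * (e * x^-1)))}.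
Proof.
exact: (continuousM_fun (@cpow (b - 1)) (continuousM_fun cp1 (continuousM_fun (@cc e) cinv))).
Qed.

End continuity.

(** * The coefficient of phi^2 produced by the weights *)

Section bracket.
Variables (g Q N al C : R).
Hypothesis a_def : a = 2 * (1 + g).
Hypothesis g0 : 0 < g.
Hypothesis b_def : b = (al - 2) / a.
Hypothesis k1_def : k1 = (2 - Q) / a.
Hypothesis N_def : N = Q + al - 4.
Hypothesis c0_def : c0 = N * (Q - al) / 4.
Hypothesis c0_gt0 : 0 < c0.
Hypothesis C_def : C = 3 * a * `|a - N - (2 - Q)| + 6 * a ^+ 2.

Definition hr u : R := (k1 - b - (lnw u)^-1) / (2 * u).

Let a0 : 0 < a. Proof. by rewrite a_def mulr_gt0// addr_gt0. Qed.

Lemma powR_shift u : 0 < u ->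
  powR u b = powR u (b - 1) * u /\ powR u (b - 2) = powR u (b - 1) / u.
Proof.
move=> u0; have un0 : u != 0 by rewrite gt_eqF.
split.
  by rewrite -[X in _ * X]powRr1 ?ltW// -powRD ?un0 ?implybT// subrK.
by rewrite -[X in _ / X]powRr1 ?ltW// -powRB ?un0 ?implybT//; congr powR; ring.
Qed.

Lemma ppow_cutoffE u : 0 < cutoff u -> [/\ ppow 3 (cutoff u) = cutoff u ^+ 3,
  ppow 2 (cutoff u) = cutoff u ^+ 2 & ppow 1 (cutoff u) = cutoff u].
Proof.
by move=> q0; rewrite !ppow_gt0// -[3]/(3%:R) -[2]/(2%:R) !powR_mulrn ?powRr1 ?ltW.
Qed.

(** The relation H = 2 W h + W' in the variable u, which lets the mixed terms in phi and grad phi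
    form a square. *)
Lemma Hr_Wr1 u : 0 < u -> Hr u - Wr1 u = 2 * Wr u * hr u.
Proof.
move=> u0; have un0 : u != 0 by rewrite gt_eqF.
have [Pb _] := powR_shift u0.
rewrite /Hr /Wr1 /Wr /hr /Er Pb; set P := powR u (b - 1).
by set L := (lnw u)^-1; field.
Qed.

Lemma Wr_ge0 u : 0 <= Wr u.
Proof. by rewrite /Wr !mulr_ge0 ?powR_ge0 ?ppow_ge0// ltW. Qed.

(* The right-hand side is kappa u^(b - 1); the terms produced by differentiating the
   cutoff are either nonnegative or at least - C q (1 - q) with q = 1 - e / u. *)
Lemma bracket_ge u : 0 < u -> 0 < lnw u ->
  c0 * (powR u (b - 1) * ppow 3 (cutoff u) *
     (c0 + a ^+ 2 / 2 * ((lnw u)^-1 * (lnw u)^-1)))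
  - c0 * C * (powR u (b - 1) * (ppow 1 (cutoff u) * (e * u^-1)))
  <= - a ^+ 2 * u * Hr1 u - a * (Q + 2 * g) * Hr u - 2 * a ^+ 2 * u * Wr u * hr u ^+ 2
     - Wr u ^+ 2 / (powR u (b - 1) * u ^+ 2).
Proof.
move=> u0 l0; have un0 : u != 0 by rewrite gt_eqF.
have [Pb Pb2] := powR_shift u0; have P0 : 0 < powR u (b - 1) by exact: powR_gt0.
have [q0|q0] := leP (cutoff u) 0.
  rewrite /Hr1 /Hr /Wr /Er !(ppow_le0 _ q0).
  by rewrite le_eqVlt; apply/orP; left; apply/eqP; ring.
have [p3 p2 p1] := ppow_cutoffE q0.
(* Every occurrence of e / u becomes 1 - q, so the bracket is c0 P times a polynomial in q and X. *)
have sE : e * u^-1 = 1 - cutoff u by rewrite cutoffE//; ring.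
have s0 : 0 < 1 - cutoff u by rewrite -sE mulr_gt0 ?invr_gt0.
set P := powR u (b - 1) in Pb Pb2 P0 *; set q := cutoff u in q0 p1 p2 p3 sE s0 *.
set X := (lnw u)^-1; have X0 : 0 < X by rewrite invr_gt0.
have eE : e * (u^-1 * u^-1) = (1 - q) * u^-1 by rewrite mulrA sE.
have eE' : e * (- 1 * (u^-1 * u^-1)) = - (1 - q) * u^-1 by rewrite mulrCA eE; ring.
have an0 : a != 0 by rewrite gt_eqF.
rewrite /Hr1 /Hr /Wr /Er /hr Pb Pb2 p3 p2 p1 eE eE' sE -/P -/X.
(* Y gathers the terms in q^2 (1 - q) without the logarithm; it accounts for the first summand of C,
   and the second derivative of the cutoff for the second. *)
pose Y := - (a - N - (2 - Q)) * 3 * a.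
have -> : - a ^+ 2 * u * (c0 * ((b - 1) * (P / u) *
      ((k1 + - 1 * X) * q ^+ 3 + 3 * q ^+ 2 * (1 - q)) +
    P * (- 1 * (X * X * u^-1) * q ^+ 3 + (k1 + - 1 * X) * (3 * q ^+ 2 * ((1 - q) * u^-1)) +
      (3 * (2 * q * ((1 - q) * u^-1)) * (1 - q) + 3 * q ^+ 2 * (- (1 - q) * u^-1))))) -
   a * (Q + 2 * g) * (c0 * (P * ((k1 + - 1 * X) * q ^+ 3 + 3 * q ^+ 2 * (1 - q)))) -
   2 * a ^+ 2 * u * (c0 * (P * u * q ^+ 3)) * ((k1 - b - X) / (2 * u)) ^+ 2 -
   (c0 * (P * u * q ^+ 3)) ^+ 2 / (P * u ^+ 2) =
   c0 * P * (q ^+ 3 * (c0 + a ^+ 2 / 2 * (X * X)) + c0 * q ^+ 3 * (1 - q ^+ 3)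
     + 3 * a ^+ 2 * X * q ^+ 2 * (1 - q) - Y * (q ^+ 2 * (1 - q))
     - 6 * a ^+ 2 * q * (1 - q) ^+ 2).
  have -> : g = a / 2 - 1 by rewrite a_def; field.
  rewrite /Y k1_def b_def c0_def N_def; field.
  by rewrite un0 an0 (gt_eqF P0).
have -> : c0 * (P * q ^+ 3 * (c0 + a ^+ 2 / 2 * (X * X))) - c0 * C * (P * (q * (1 - q))) =
  c0 * P * (q ^+ 3 * (c0 + a ^+ 2 / 2 * (X * X)) - C * (q * (1 - q))) by ring.
rewrite ler_pM2l ?mulr_gt0//.
have q1 : q < 1 by lra.
have h1 : 0 <= c0 * q ^+ 3 * (1 - q ^+ 3).
  apply: mulr_ge0; first by rewrite mulr_ge0 ?exprn_ge0// ltW.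
  by rewrite subr_ge0 exprn_ile1// ltW.
have h2 : 0 <= 3 * a ^+ 2 * X * q ^+ 2 * (1 - q).
  have a2 := sqr_ge0 a; have q2 := sqr_ge0 q.
  exact: (mulr_ge0 (mulr_ge0 (mulr_ge0 (mulr_ge0 (ler0n R 3) a2) (ltW X0)) q2) (ltW s0)).
have qs0 : 0 < q * (1 - q) by rewrite mulr_gt0.
have h3 : Y * (q ^+ 2 * (1 - q)) <= 3 * a * `|a - N - (2 - Q)| * (q * (1 - q)).
  pose A := `|a - N - (2 - Q)|; have A0 : 0 <= A by exact: normr_ge0.
  have YY : Y <= 3 * a * A.
    rewrite (_ : Y = 3 * a * (- (a - N - (2 - Q)))); last by rewrite /Y; ring.
    apply: ler_wpM2l; first by rewrite mulr_ge0// ltW.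
    by rewrite /A -normrN ler_norm.
  have YN : 0 <= 3 * a * A by rewrite !mulr_ge0// ltW.
  rewrite -/A (_ : q ^+ 2 * (1 - q) = q * (q * (1 - q))); last by ring.
  have Yq : Y * q <= 3 * a * A.
    by apply: le_trans (ler_wpM2r (ltW q0) YY) _; rewrite ler_piMr// ltW.
  by rewrite [leLHS]mulrA ler_pM2r.
have h4 : 6 * a ^+ 2 * q * (1 - q) ^+ 2 <= 6 * a ^+ 2 * (q * (1 - q)).
  have a2 := sqr_ge0 a.
  rewrite (_ : 6 * a ^+ 2 * q * (1 - q) ^+ 2 = a ^+ 2 * (6 * (q * (1 - q)) * (1 - q))); last by ring.
  rewrite (_ : 6 * a ^+ 2 * (q * (1 - q)) = a ^+ 2 * (6 * (q * (1 - q)))); last by ring.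
  by apply: ler_wpM2l => //; nra.
by rewrite C_def mulrDl; lra.
Qed.

End bracket.
End radial_weights.

(** * The gauge in terms of u, and the pointwise inequality *)

Section pointwise.
Variables (R : realType) (m k : nat) (g : R).
Notation n := (m + k)%N.
Variables (phi : 'rV[R]_n -> R) (W H W1 H1 : R -> R).
Implicit Types z : 'rV[R]_n.

Lemma enorm_lsubmx z : enorm (lsubmx z) = Num.sqrt (sqx z).
Proof.
rewrite /enorm /sqx /sumsq big_split_ord /= [X in _ + X]big1 ?addr0; last first.
  by move=> i; rewrite ltnNge leq_addr.
by congr Num.sqrt; apply: eq_big => i; rewrite ?ltn_ord// mxE.
Qed.

Lemma enorm_rsubmx z : enorm (rsubmx z) = Num.sqrt (sqy z).
Proof.
rewrite /enorm /sqy /sumsq big_split_ord /= [X in X + _]big1 ?add0r; last first.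
  by move=> i; rewrite leqNgt ltn_ord.
by congr Num.sqrt; apply: eq_big => i; rewrite ?leq_addr// mxE.
Qed.

(** At S = 0 both sides are 0 because d is nonzero, whereas [powR 0 0] is 1. *)
Lemma powR_sqrt (S d : R) : 0 <= S -> d != 0 -> powR (Num.sqrt S) (2 * d) = ppow d S.
Proof.
move=> S0 d0; rewrite -powR12_sqrt// -powRrM mulrA mulVf// mul1r /ppow.
case: ltP => // S0'; have -> : S = 0 by apply/eqP; rewrite eq_le S0 S0'.
by rewrite powR0.
Qed.

Hypothesis g0 : 0 < g.

Lemma gaugeE z : gauge m k g z = powR (ug g z) (2 * (1 + g))^-1.
Proof.
rewrite /gauge /ug enorm_lsubmx enorm_rsubmx sqr_sqrtr ?sumsq_ge0//.
by rewrite powR_sqrt ?sumsq_ge0// ?gt_eqF// ?addr_gt0// div1r.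
Qed.

Lemma powR_enormx z : powR (enorm (lsubmx z)) (2 * g) = wx g z.
Proof. by rewrite enorm_lsubmx powR_sqrt ?sumsq_ge0// gt_eqF. Qed.

Lemma Delta_BG_sum z : Delta_BG m k g phi z = \sum_i wt g i z * ddphi phi i z.
Proof.
rewrite /Delta_BG powR_enormx sum_split mulr_sumr; congr (_ + _); apply: eq_bigr => i im.
  by rewrite /wt im mul1r.
by rewrite /wt ltnNge im.
Qed.

Lemma is_derive_gauge z i : 0 < ug g z ->
  is_derive z (delta_mx 0 i : 'rV[R]_n) (gauge m k g)
    ((2 * (1 + g))^-1 * powR (ug g z) ((2 * (1 + g))^-1 - 1) * du g i z).
Proof.
move=> u0; rewrite (_ : gauge m k g = fun z => powR (ug g z) (2 * (1 + g))^-1); last first.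
  by apply/funext => y; exact: gaugeE.
exact: (is_derive_comp_fun (is_derive_ug g0 i z) (is_derive1_powR _ u0)).
Qed.

(** Since 2 / a - 1 = - 2 g / a, this is the identity |grad rho|^2 = |x|^(2 g) / rho^(2 g). *)
Lemma grad_gauge_sqr z : 0 < ug g z ->
  enorm (grad_BG m k g (gauge m k g) z) ^+ 2 =
  wx g z * powR (ug g z) (2 / (2 * (1 + g)) - 1).
Proof.
move=> u0; rewrite /enorm sqr_sqrtr; last by apply: sumr_ge0 => i _; exact: sqr_ge0.
set a := 2 * (1 + g).
have a0 : a != 0 by rewrite gt_eqF// mulr_gt0// addr_gt0.
have un0 : ug g z != 0 by rewrite gt_eqF.
transitivity (\sum_i (a^-1 * powR (ug g z) (a^-1 - 1)) ^+ 2 * (wt g i z * du g i z ^+ 2)).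
  apply: eq_bigr => i _; rewrite mxE /partial.
  have [_ ->] := is_derive_gauge i u0; rewrite -/a /wt; case: ifPn => im; first by ring.
  rewrite [LHS]exprMn (_ : powR (enorm (lsubmx z)) g ^+ 2 = wx g z); first by ring.
  have := powR_mulrn 2 (powR_ge0 (enorm (lsubmx z)) g); rewrite -powRrM mulrC => <-.
  exact: powR_enormx.
rewrite -mulr_sumr (sum_gamma_u g0) -/a.
have -> : powR (ug g z) (2 / a - 1) = powR (ug g z) (a^-1 - 1) ^+ 2 * ug g z.
  have := powR_mulrn 2 (powR_ge0 (ug g z) (a^-1 - 1)); rewrite -powRrM => <-.
  rewrite -[X in _ = _ * X]powRr1 ?ltW// -powRD ?un0 ?implybT//.
  by congr powR; field.
by field.
Qed.

Lemma ug_gt0 z : 0 < sqx z -> 0 < ug g z.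
Proof.
move=> S0; apply: ltr_wpDr; first by rewrite mulr_ge0 ?sqr_ge0 ?sumsq_ge0.
by rewrite ppow_gt0// powR_gt0.
Qed.

(** P2 will be u^(b + 1), for which P2 / [wx] = rho^alpha / |grad rho|^2. The right side exceeds the
    left by exactly two nonnegative terms, [yg] and twice [sq2]. *)
Lemma div_vfield_le z (h P2 : R) : 0 < wx g z -> 0 < P2 -> 0 <= W (ug g z) ->
  H (ug g z) - W1 (ug g z) = 2 * W (ug g z) * h ->
  2 * (\sum_i dvfield g phi W H W1 H1 i z) + phi z * phi z * (wx g z *
    (- (2 * (1 + g)) ^+ 2 * ug g z * H1 (ug g z)
     - 2 * (1 + g) * (homdim m k g + 2 * g) * H (ug g z)
     - 2 * (2 * (1 + g)) ^+ 2 * ug g z * W (ug g z) * h ^+ 2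
     - W (ug g z) ^+ 2 / P2)) <=
  (\sum_i wt g i z * ddphi phi i z) ^+ 2 * P2 / wx g z.
Proof.
move=> w0 P0 W0 HW.
set u := ug g z in W0 HW *.
pose G1 := \sum_i wt g i z * (du g i z * dphi phi i z).
pose Gp := \sum_i wt g i z * (dphi phi i z * dphi phi i z).
set D := \sum_i wt g i z * ddphi phi i z.
have Gu := sum_gamma_u g0 z; have La := sum_lap_u g0 z.
have -> : \sum_i dvfield g phi W H W1 H1 i z =
   (phi z * (H u - W1 u)) * G1 + (- W u) * Gp + (- (W u * phi z)) * D +
   (2^-1 * phi z * phi z * H1 u) * (\sum_i wt g i z * du g i z ^+ 2) +
   (2^-1 * phi z * phi z * H u) * (\sum_i wt g i z * ddu g i z).
  rewrite /G1 /Gp /D !mulr_sumr -!big_split /=; apply: eq_bigr => i _.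
  by rewrite /dvfield -/u; field.
(* The squared Grushin length of grad phi - h phi grad u, expanded. *)
have sq : 0 <= Gp - 2 * h * phi z * G1 + h ^+ 2 * phi z ^+ 2 * (\sum_i wt g i z * du g i z ^+ 2).
  have -> : Gp - 2 * h * phi z * G1 + h ^+ 2 * phi z ^+ 2 * (\sum_i wt g i z * du g i z ^+ 2) =
     \sum_i wt g i z * (dphi phi i z - h * phi z * du g i z) ^+ 2.
    rewrite /G1 /Gp -mulNr !mulr_sumr -!big_split /=; apply: eq_bigr => i _; ring.
  by apply: sumr_ge0 => i _; rewrite mulr_ge0 ?wt_ge0 ?sqr_ge0.
rewrite HW; rewrite Gu in sq *; rewrite La -/u in sq *.
set w := wx g z in w0 sq *.
(* The completed square in D = Delta phi. *)
have yg : 0 <= D ^+ 2 * P2 / w + 2 * W u * phi z * D + W u ^+ 2 * phi z ^+ 2 * w / P2.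
  have -> : D ^+ 2 * P2 / w + 2 * W u * phi z * D + W u ^+ 2 * phi z ^+ 2 * w / P2 =
    (D * P2 + W u * phi z * w) ^+ 2 / (w * P2) by field; rewrite !gt_eqF.
  by rewrite divr_ge0 ?sqr_ge0// mulr_ge0// ltW.
have sq2 := mulr_ge0 W0 sq.
set LHS := (X in X <= _).
have -> : LHS = D ^+ 2 * P2 / w -
  (D ^+ 2 * P2 / w + 2 * W u * phi z * D + W u ^+ 2 * phi z ^+ 2 * w / P2) -
  2 * (W u * (Gp - 2 * h * phi z * G1 + h ^+ 2 * phi z ^+ 2 * ((2 * (1 + g)) ^+ 2 * w * u))).
  by rewrite /LHS; field; rewrite !gt_eqF.
lra.
Qed.

End pointwise.

(** * The integrated inequality with cutoff *)

Section hardy_rellich.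
Variables (R : realType) (m k : nat) (g al r : R).
Notation n := (m + k)%N.
Variable phi : 'rV[R]_n -> R.
Implicit Types z : 'rV[R]_n.
Hypothesis m0 : (0 < m)%N.
Hypothesis g0 : 0 < g.
Hypothesis al1 : 4 - homdim m k g < al.
Hypothesis al2 : al < homdim m k g.
Hypothesis r0 : 0 < r.
Hypothesis hphi : Cc_infty (ball_BG m k g r) phi.

Let a : R := 2 * (1 + g).
Let Q : R := homdim m k g.
Let N : R := Q + al - 4.
Let c0 : R := N * (Q - al) / 4.
Let k1 : R := (2 - Q) / a.
Let b : R := (al - 2) / a.
Let C : R := 3 * a * `|a - N - (2 - Q)| + 6 * a ^+ 2.
Let lr : R := a * ln r.
Let R0 : R := powR r a.

Let a0 : 0 < a. Proof. by rewrite mulr_gt0// addr_gt0. Qed.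
Let N0 : 0 < N. Proof. by rewrite /N /Q; move: al1; lra. Qed.
Let c00 : 0 < c0.
Proof. by rewrite /c0 divr_gt0// mulr_gt0// subr_gt0. Qed.

Lemma gauge_lt z : (gauge m k g z < r) = (ug g z < R0).
Proof.
have rE : r = powR R0 a^-1 by rewrite -powRrM mulfV ?gt_eqF// powRr1// ltW.
rewrite gaugeE// -/a [X in _ < X]rE; apply/idP/idP => [|h].
  apply: contraTT; rewrite -!leNgt => h.
  by rewrite ge0_ler_powR ?nnegrE ?ug_ge0 ?powR_ge0// invr_ge0 ltW.
by rewrite gt0_ltr_powR ?invr_gt0 ?nnegrE ?ug_ge0 ?powR_ge0.
Qed.

Let sm : smooth phi. Proof. by case: hphi. Qed.
Let cp : compact (supp phi). Proof. by case: hphi => _ []. Qed.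
Let sp : supp phi `<=` [set z | ug g z < R0].
Proof. by case: hphi => _ [_ h] z /h /=; rewrite /ball_BG /= gauge_lt. Qed.

Lemma lnw_gt0 u : 0 < u -> u < R0 -> 0 < lnw lr u.
Proof.
move=> u0 uR; rewrite /lnw subr_gt0 /lr -ln_powR ltr_ln ?posrE//.
by rewrite powR_gt0.
Qed.

(* Truncations of the two integrands of the lower bound, and the error term. *)
Let Ie e z := phi z * phi z *
  (wx g z * (powR (ug g z) (b - 1) * ppow 3 (cutoff e (ug g z)))).
Let Je e z := phi z * phi z *
  (wx g z * (powR (ug g z) (b - 1) * ppow 3 (cutoff e (ug g z)) *
     ((lnw lr (ug g z))^-1 * (lnw lr (ug g z))^-1))).
Let Ee e z := phi z * phi z *
  (wx g z * (powR (ug g z) (b - 1) * (ppow 1 (cutoff e (ug g z)) * (e * (ug g z)^-1)))).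

Lemma cut_ucs e : 0 < e -> [/\ ucs (Ie e), ucs (Je e) & ucs (Ee e)].
Proof.
move=> e0; have l0 (u : R) : 0 < u -> u < R0 -> lnw lr u != 0.
  by move=> u0 u1; rewrite gt_eqF// lnw_gt0.
split.
- apply: (ucs_weight g0 e0 sm cp sp
    (K := fun u => powR u (b - 1) * ppow 3 (cutoff e u))).
  + move=> u u0 u1; exact: (@main_weight_continuous R b e u u0).
  + by move=> u u0 ue; rewrite (ppow_le0 _ (cutoff_le0 u0 ue)) mulr0.
- apply: (ucs_weight g0 e0 sm cp sp (K := fun u => powR u (b - 1) * ppow 3 (cutoff e u) *
     ((lnw lr u)^-1 * (lnw lr u)^-1))).
  + move=> u u0 u1; exact: (@log_weight_continuous R b lr e u u0 (l0 _ u0 u1)).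
  + by move=> u u0 ue; rewrite (ppow_le0 _ (cutoff_le0 u0 ue)) mulr0 mul0r.
- apply: (ucs_weight g0 e0 sm cp sp (K := fun u =>
      powR u (b - 1) * (ppow 1 (cutoff e u) * (e * u^-1)))).
  + move=> u u0 u1; exact: (@error_weight_continuous R b e u u0).
  + by move=> u u0 ue; rewrite (ppow_le0 _ (cutoff_le0 u0 ue)) mul0r mulr0.
Qed.

Let rho := gauge m k g.
Let ngr z := enorm (grad_BG m k g rho z).
Let B := ball_BG m k g r.
(** The inverse is extended-real, so L may be infinite where grad rho vanishes; inside the ball this
    needs a zero coordinate, and such points are ignored by [le_Iint_iint]. *)
Let L z : \bar R := if `[< B z >] then
  ((powR (rho z) al * Delta_BG m k g phi z ^+ 2)%:E * ((ngr z ^+ 2)%:E)^-1)%E else 0%E.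

Lemma L_ge0 z : (0 <= L z)%E.
Proof.
rewrite /L; case: ifP => // _; apply: mule_ge0.
  by rewrite lee_fin mulr_ge0 ?powR_ge0 ?sqr_ge0.
by rewrite inve_ge0 lee_fin sqr_ge0.
Qed.

Lemma sqx_gt0 z : (forall i, z 0 i != 0) -> 0 < sqx z.
Proof.
move=> z0; pose i : 'I_n := lshift k (Ordinal m0).
apply: (@lt_le_trans _ _ (z 0 i ^+ 2)); first by rewrite lt_neqAle sqr_ge0 eq_sym sqrf_eq0 z0.
exact: (sqr_le_sumsq (P := fun i : 'I_n => (i < m)%N)).
Qed.

Lemma wx_gt0 z : (forall i, z 0 i != 0) -> 0 < wx g z.
Proof. by move=> /sqx_gt0 S0; rewrite /wx ppow_gt0// powR_gt0. Qed.

Lemma rho_powR z (d : R) : powR (rho z) d = powR (ug g z) (d / a).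
Proof. by rewrite /rho gaugeE// -powRrM mulrC. Qed.

Lemma nsupp_ball z : ~ B z -> ~ supp phi z.
Proof. by move=> nB /sp /=; rewrite -gauge_lt. Qed.

(** The pointwise inequality and the bracket bound are integrated; the divergence contributes
    zero. *)
Lemma cut_ineq e : 0 < e ->
  ((c0 ^+ 2 * Iint (Ie e) + c0 * a ^+ 2 / 2 * Iint (Je e)
    - c0 * C * Iint (Ee e))%:E <= iint L)%E.
Proof.
move=> e0; have [uI uJ uE] := cut_ucs e0.
pose W := Wr b c0 e; pose W1 := Wr1 b c0 e.
pose H := Hr b c0 k1 lr e; pose H1 := Hr1 b c0 k1 lr e.
have l0 (u : R) : 0 < u -> u < R0 -> lnw lr u != 0.
  by move=> u0 u1; rewrite gt_eqF// lnw_gt0.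
have [uD ID] := div_vfield g0 e0 sm cp sp (W := W) (H := H) (W1 := W1) (H1 := H1)
  (fun u u0 _ => @is_derive_Wr R b c0 e u u0)
  (fun u u0 u1 => @is_derive_Hr R b c0 k1 lr e u u0 (l0 u u0 u1))
  (fun u u0 _ => @Wr1_continuous R b c0 e u u0)
  (fun u u0 u1 => @Hr1_continuous R b c0 k1 lr e u u0 (l0 u u0 u1)) (@WHr0 R b c0 k1 lr e).
set dv := (fun z => \sum_i _) in uD ID.
(* The minorant is assembled in the nested form c f + f', ending in the zero function, so that
   [Iint_lin] unfolds it. *)
have uE0 := ucs_lin _ _ _ _ (- (c0 * C)) uE (ucs0 R n).
have uJE := ucs_lin _ _ _ _ (c0 * a ^+ 2 / 2) uJ uE0.
have uIJE := ucs_lin _ _ _ _ (c0 ^+ 2) uI uJE.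
have uP := ucs_lin _ _ _ _ 2 uD uIJE.
have := @le_Iint_iint _ _ _ L uP L_ge0.
rewrite (@Iint_lin R n _ _ 2 uD uIJE) (@Iint_lin R n _ _ _ uI uJE) (@Iint_lin R n _ _ _ uJ uE0).
rewrite (@Iint_lin R n _ _ _ uE (ucs0 R n)) ID Iint0 mulr0 add0r addr0 addrA mulNr.
apply => z z0.
rewrite /L; have S0 := sqx_gt0 z0; have u0 : 0 < ug g z by exact: ug_gt0.
have w0 := wx_gt0 z0.
have P0 : 0 < powR (ug g z) (b - 1) by exact: powR_gt0.
case: asboolP => [Bz|/nsupp_ball nz]; last first.
  rewrite lee_fin le_eqVlt; apply/orP; left; apply/eqP.
  rewrite /dv big1; last by move=> i _; rewrite /dvfield (phi_nsupp nz) (dphi_nsupp i nz); ring.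
  by rewrite /Ie /Je /Ee (phi_nsupp nz); ring.
have u1 : ug g z < R0 by rewrite -gauge_lt.
have nE : ngr z ^+ 2 = wx g z * powR (ug g z) (2 / a - 1) by exact: grad_gauge_sqr.
have pw0 : 0 < powR (ug g z) (2 / a - 1) by exact: powR_gt0.
rewrite nE inver gt_eqF ?mulr_gt0// -EFinM lee_fin.
have un0 : ug g z != 0 by rewrite gt_eqF.
(* Power count: al / a = (b - 1) + 2 + (2 / a - 1), which identifies P2 as u^(b - 1) u^2. *)
have -> : powR (rho z) al * Delta_BG m k g phi z ^+ 2 / (wx g z * powR (ug g z) (2 / a - 1)) =
  (\sum_i wt g i z * ddphi phi i z) ^+ 2 * (powR (ug g z) (b - 1) * ug g z ^+ 2) / wx g z.
  rewrite rho_powR Delta_BG_sum//.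
  have -> : powR (ug g z) (al / a) =
     powR (ug g z) (b - 1) * ug g z ^+ 2 * powR (ug g z) (2 / a - 1).
    rewrite -powR_mulrn ?ug_ge0// -!powRD ?un0 ?implybT//; congr powR; rewrite /b; field.
    by rewrite gt_eqF.
  by field; rewrite !gt_eqF.
have dl := @div_vfield_le R m k g phi W H W1 H1 g0 z (hr b k1 lr (ug g z)) _ w0
  (mulr_gt0 P0 (exprn_gt0 2 u0)) (Wr_ge0 b e c00 (ug g z)) (Hr_Wr1 b c0 k1 lr e u0).
apply: (le_trans _ dl); rewrite /dv lerD2l addr0.
have br := @bracket_ge R a b c0 k1 lr e e0 g Q N al C erefl g0 erefl erefl erefl erefl c00 erefl
  _ u0 (lnw_gt0 u0 u1).
have := ler_wpM2l (mulr_ge0 (sqr_ge0 (phi z)) (ltW w0)) br.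
rewrite expr2 -[leRHS]mulrA; apply: le_trans.
by rewrite le_eqVlt; apply/orP; left; apply/eqP; rewrite /Ie /Je /Ee; ring.
Qed.

(** * Smallness of the error term *)

Let Q2 : 2 < Q. Proof. by rewrite /Q; move: al1 al2; lra. Qed.

Lemma coord_le_ug z i : `|z 0 i| <= powR (ug g z) (if (i < m)%N then a^-1 else 2^-1).
Proof.
have T0 : 0 <= (1 + g) ^+ 2 * sqy z by rewrite mulr_ge0 ?sqr_ge0 ?sumsq_ge0.
case: ifPn => im.
  have zE : `|z 0 i| = powR (powR (`|z 0 i|) a) a^-1.
    by rewrite -powRrM mulfV ?gt_eqF// powRr1.
  rewrite [leLHS]zE ge0_ler_powR ?nnegrE ?powR_ge0 ?ug_ge0 ?invr_ge0 ?(ltW a0)//.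
  apply: (@le_trans _ _ (ppow (1 + g) (sqx z))); last by rewrite lerDl.
  have -> : powR `|z 0 i| a = powR (z 0 i ^+ 2) (1 + g).
    by rewrite /a powRrM powR_mulrn// real_normK ?num_real.
  rewrite /ppow; case: ltP => S0.
    have g1 : 0 <= 1 + g by rewrite ltW// addr_gt0.
    apply: (ge0_ler_powR g1); rewrite ?nnegrE ?sqr_ge0 ?sumsq_ge0//.
    exact: (sqr_le_sumsq (P := fun i : 'I_n => (i < m)%N)).
  have := sqr_le_sumsq (P := fun i : 'I_n => (i < m)%N) z im; rewrite -/(sqx z) => zS.
  have -> : z 0 i ^+ 2 = 0 by apply/eqP; rewrite eq_le sqr_ge0 (le_trans zS S0).
  by rewrite powR0// gt_eqF// addr_gt0.
rewrite -sqrtr_sqr -powR12_sqrt ?sqr_ge0// ge0_ler_powR ?nnegrE ?sqr_ge0 ?ug_ge0//.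
have := sqr_le_sumsq (P := fun i : 'I_n => (m <= i)%N) z (i := i).
rewrite -/(sqy z) leqNgt im => /(_ isT) zT; apply: (le_trans zT).
apply: (@le_trans _ _ ((1 + g) ^+ 2 * sqy z)); last by rewrite lerDr ppow_ge0.
by rewrite ler_peMl ?sumsq_ge0// exprn_ege1// lerDl ltW.
Qed.

(* |x_i| <= rho and |y_j| <= rho^(1 + gamma), and the homogeneous degrees of the
   coordinates add up to Q. *)
Lemma powR_ug_le_prod z (th : R) : 0 < th -> (forall i, z 0 i != 0) ->
  powR (ug g z) (- (th * Q / a)) <= \prod_i powR `|z 0 i| (- th).
Proof.
move=> th0 z0; have u0 : 0 < ug g z by exact/ug_gt0/sqx_gt0.
have -> : - (th * Q / a) = \sum_(i < n) (if (i < m)%N then a^-1 else 2^-1) * - th.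
  rewrite -mulr_suml big_split_ord /= (eq_bigr (fun=> a^-1)); last by move=> i _; rewrite ltn_ord.
  rewrite [X in (_ + X)](eq_bigr (fun=> 2^-1)); last by move=> i _; rewrite ltnNge leq_addr.
  rewrite !sumr_const !card_ord -[_ *+ m]mulr_natr -[_ *+ k]mulr_natr /Q /homdim /a; field.
  by rewrite gt_eqF// addr_gt0.
rewrite powR_sum//; apply: ler_prod => i _; rewrite powR_ge0 /= powRrM.
by apply: ler_powRN; [rewrite normr_gt0|exact: coord_le_ug|exact: ltW].
Qed.

Lemma phi_bounded : exists2 c, 0 <= c & forall z, `|phi z| <= c.
Proof.
have cphi : {within supp phi, continuous phi}.
  by apply: continuous_subspaceT => z; exact: (phi_continuous sm).
have [M [_ HM]] := compact_bounded (continuous_compact cphi cp).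
exists (`|M| + 1); first by rewrite addr_ge0.
move=> z; have [sz|/phi_nsupp ->] := pselect (supp phi z); last by rewrite normr0 addr_ge0.
by apply: (HM (`|M| + 1)); [have := ler_norm M; lra|exists z].
Qed.

(** Where the cutoff is active e / u <= 1, so e / u <= e^d u^(- d). The remaining power of u splits
    into a bounded factor u^E2 and u^(- th Q / a), which is dominated by an integrable product of
    powers |z_i|^(- th). *)
Lemma Iint_error_le : exists K, exists2 d, 0 < d &
  forall e, 0 < e -> Iint (Ee e) <= K * powR e d.
Proof.
(* With th = 1 - eta one has a E2 = N - eta Q - d a, so allotting N / 2 to each of eta Q and d a
   gives E2 >= 0. The other bounds ensure 0 < th < 1 and d <= 1. *)
pose eta := Num.min (2^-1) (N / (2 * Q)).
pose th := 1 - eta; pose d := Num.min 1 (N / (2 * a)).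
have Q0 : 0 < 2 * Q by have := Q2; lra.
have eta0 : 0 < eta by rewrite lt_min invr_gt0 ltr0n divr_gt0.
have eta2 : eta <= 2^-1 by rewrite ge_min lexx.
have etaQ : eta * Q <= N / 2.
  have : eta <= N / (2 * Q) by rewrite ge_min lexx orbT.
  by rewrite ler_pdivlMr//; lra.
have th0 : 0 < th by rewrite /th; lra.
have th1 : th < 1 by rewrite /th; lra.
have d0 : 0 < d by rewrite lt_min ltr01 divr_gt0// mulr_gt0.
have d1 : d <= 1 by rewrite ge_min lexx.
have da : d * a <= N / 2.
  have : d <= N / (2 * a) by rewrite ge_min lexx orbT.
  have a20 : 0 < 2 * a by exact: mulr_gt0 _ a0.
  rewrite ler_pdivlMr// => da; have -> : d * a = d * (2 * a) / 2 by field.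
  by rewrite ler_pM2r.
have [M0 HM0] := supp_phi_box cp; pose M := `|M0| + 1.
have M_gt0 : 0 < M by rewrite ltr_wpDl.
have HM z i : supp phi z -> `|z 0 i| <= M.
  move=> sz; rewrite leNgt; apply/negP => Mz; apply: (HM0 z) => //.
  by exists i; have := ler_norm M0; rewrite /M in Mz; lra.
have [c cc0 phic] := phi_bounded.
have [mh [I hI]] := integral_trunc_powRN th0 th1 M_gt0.
(* E1 adds the exponents from [wx] <= u^(g / (1 + g)), the weight u^(b - 1), and u^(- d). *)
pose E1 := g / (1 + g) + b - 1 - d; pose E2 := E1 + th * Q / a.
have E20 : 0 <= E2.
  have -> : E2 = (al - 4 - d * a + th * Q) / a.
    by rewrite /E2 /E1 /b /a; field; rewrite gt_eqF// addr_gt0.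
  by rewrite divr_ge0 ?(ltW a0)// /th; rewrite /N in etaQ da; lra.
exists (c ^+ 2 * powR R0 E2 * I ^+ n), d => // e e0.
have [_ _ uE] := cut_ucs e0.
have C1 : 0 <= c ^+ 2 * powR R0 E2 * powR e d by rewrite !mulr_ge0 ?sqr_ge0 ?powR_ge0.
rewrite -lee_fin mulrAC -(iint_prod n mh (trunc_powRN_ge0 th M) hI C1).
have pge0 z : 0 <= c ^+ 2 * powR R0 E2 * powR e d * \prod_i trunc_powRN th M (z 0 i).
  by apply: mulr_ge0 => //; apply: prodr_ge0 => i _; exact: trunc_powRN_ge0.
apply: le_Iint_iint => // z z0; rewrite lee_fin.
have [sz|nz] := pselect (supp phi z); last by rewrite /Ee (phi_nsupp nz) !mul0r.
have -> : \prod_i trunc_powRN th M (z 0 i) = \prod_i powR `|z 0 i| (- th).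
  by apply: eq_bigr => i _; rewrite /trunc_powRN HM.
have S0 := sqx_gt0 z0; have u0 : 0 < ug g z by exact: ug_gt0.
have w0 := wx_gt0 z0; have u1 : ug g z < R0 by exact: sp.
have un0 : ug g z != 0 by rewrite gt_eqF.
have prod_ge0 : 0 <= \prod_i powR `|z 0 i| (- th) by apply: prodr_ge0 => i _; exact: powR_ge0.
rewrite /Ee; have [q0|q0] := leP (cutoff e (ug g z)) 0.
  by rewrite (ppow_le0 _ q0) mul0r !mulr0 !mulr_ge0 ?sqr_ge0 ?powR_ge0.
have eu : 0 < e / ug g z <= 1.
  by rewrite divr_gt0//= ltW// -subr_gt0 -cutoffE.
have wle : wx g z <= powR (ug g z) (g / (1 + g)).
  have -> : wx g z = powR (powR (sqx z) (1 + g)) (g / (1 + g)).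
    by rewrite /wx ppow_gt0// -powRrM mulrCA mulfV ?mulr1// gt_eqF// addr_gt0.
  rewrite ge0_ler_powR ?nnegrE ?powR_ge0 ?ug_ge0//.
    by rewrite divr_ge0 ?addr_ge0 ?ltW.
  by rewrite /ug ppow_gt0// lerDl mulr_ge0 ?sqr_ge0 ?sumsq_ge0.
have ppow1 : ppow 1 (cutoff e (ug g z)) <= 1.
  rewrite ppow_gt0// powRr1 ?(ltW q0)// (cutoffE e u0) gerBl.
  by case/andP: eu => /ltW.
have eud : e / ug g z <= powR e d * powR (ug g z) (- d).
  apply: (le_trans (ger1_powR eu d1)).
  by rewrite powRM ?(ltW e0) ?invr_ge0 ?ug_ge0// -powR_inv1 ?ug_ge0// -powRrM mulN1r.
have eu0 : 0 <= e / ug g z by case/andP: eu => /ltW.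
have pp : phi z * phi z <= c ^+ 2.
  by rewrite -expr2 -real_normK ?num_real// lerXn2r ?nnegrE.
have step : wx g z * (powR (ug g z) (b - 1) * (ppow 1 (cutoff e (ug g z)) * (e * (ug g z)^-1)))
   <= powR (ug g z) E1 * powR e d.
  have -> : powR (ug g z) E1 * powR e d = powR (ug g z) (g / (1 + g)) *
      (powR (ug g z) (b - 1) * (1 * (powR e d * powR (ug g z) (- d)))).
    have -> : E1 = g / (1 + g) + (b - 1 + - d) by rewrite /E1; ring.
    by rewrite !powRD ?un0 ?implybT//; ring.
  have q1 := ppow_ge0 1 (cutoff e (ug g z)); have P0 := powR_ge0 (ug g z) (b - 1).
  apply: (ler_pM (ltW w0) (mulr_ge0 P0 (mulr_ge0 q1 eu0)) wle).
  exact: (ler_wpM2l P0 (ler_pM q1 eu0 ppow1 eud)).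
have u12 : powR (ug g z) E1 <= powR R0 E2 * \prod_i powR `|z 0 i| (- th).
  have -> : E1 = E2 + - (th * Q / a) by rewrite /E2; ring.
  rewrite powRD ?un0 ?implybT// ler_pM ?powR_ge0//; last exact: powR_ug_le_prod.
  by rewrite ge0_ler_powR ?nnegrE ?ug_ge0 ?powR_ge0// ltW.
have -> : c ^+ 2 * powR R0 E2 * powR e d * \prod_i powR `|z 0 i| (- th) =
  c ^+ 2 * (powR R0 E2 * \prod_i powR `|z 0 i| (- th) * powR e d) by ring.
apply: ler_pM => //; first by rewrite -expr2 sqr_ge0.
  have q1 := ppow_ge0 1 (cutoff e (ug g z)); have P0 := powR_ge0 (ug g z) (b - 1).
  exact: (mulr_ge0 (ltW w0) (mulr_ge0 P0 (mulr_ge0 q1 eu0))).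
by apply: (le_trans step); rewrite ler_wpM2r// powR_ge0.
Qed.

(** * Removal of the cutoff along e = 1 / (q + 1) *)

Lemma cutoff_le (e1 e2 u : R) : 0 <= u -> e2 <= e1 -> cutoff e1 u <= cutoff e2 u.
Proof. by move=> u0 e12; rewrite /cutoff ler_wpM2r ?invr_ge0// lerB. Qed.

Lemma ppow3_cutoff_cvg (u : R) : 0 < u ->
  ppow 3 (cutoff (@harmonic R n) u) @[n --> \oo] --> (1 : R).
Proof.
move=> u0; have p1 : ppow 3 (1 : R) = 1 by rewrite ppow_gt0// powR1.
have p3 : ppow 3 x @[x --> (1 : R)] --> (1 : R).
  by rewrite -[X in _ --> X]p1; exact: ppow_continuous.
suff cq : cutoff (@harmonic R n) u @[n --> \oo] --> (1 : R) by exact: cvg_comp cq p3.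
rewrite -[X in _ --> X](_ : (u - 0) / u = 1); last by rewrite subr0 divff// gt_eqF.
apply: cvgM; last exact: cvg_cst.
by apply: cvgB; [exact: cvg_cst|exact: cvg_harmonic].
Qed.

Let If z : \bar R := if `[< B z >] then
  (powR (rho z) (al - 4) * ngr z ^+ 2 * phi z ^+ 2)%:E else 0%E.
Let Jf z : \bar R := if `[< B z >] then
  (powR (rho z) (al - 4) * ngr z ^+ 2 * phi z ^+ 2 / (ln (r / rho z)) ^+ 2)%:E else 0%E.

Lemma harmonic_gt0 q : 0 < @harmonic R q.
Proof. by rewrite invr_gt0 ltr0n. Qed.

Lemma Ie_ge0 e z : 0 <= Ie e z.
Proof.
by rewrite /Ie mulr_ge0 -?expr2 ?sqr_ge0// !mulr_ge0 ?powR_ge0 ?ppow_ge0.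
Qed.

Lemma Ie_nd z : nondecreasing_seq (fun q => Ie (@harmonic R q) z).
Proof.
move=> q1 q2 q12; rewrite /Ie; apply: ler_wpM2l; first by rewrite -expr2 sqr_ge0.
apply: ler_wpM2l; first exact: ppow_ge0.
apply: ler_wpM2l; first exact: powR_ge0.
apply: ppow_le => //; apply: cutoff_le; first exact: ug_ge0.
by rewrite /harmonic lef_pV2 ?posrE ?ltr0n// ler_nat.
Qed.

Lemma JeE e z : Je e z = Ie e z * ((lnw lr (ug g z))^-1 * (lnw lr (ug g z))^-1).
Proof. by rewrite /Je /Ie; ring. Qed.

Lemma weightE z : 0 < ug g z ->
  powR (rho z) (al - 4) * ngr z ^+ 2 * phi z ^+ 2 =
  phi z * phi z * (wx g z * powR (ug g z) (b - 1)).
Proof.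
move=> u0; have un0 : ug g z != 0 by rewrite gt_eqF.
rewrite /ngr grad_gauge_sqr// rho_powR -/a.
have -> : powR (ug g z) (b - 1) = powR (ug g z) ((al - 4) / a) * powR (ug g z) (2 / a - 1).
  rewrite -powRD ?un0 ?implybT//; congr powR; rewrite /b; field.
  by rewrite gt_eqF.
ring.
Qed.

Lemma Ie_cvg z : (forall i, z 0 i != 0) ->
  Ie (@harmonic R q) z @[q --> \oo] --> phi z * phi z * (wx g z * powR (ug g z) (b - 1)).
Proof.
move=> z0; have u0 : 0 < ug g z by exact/ug_gt0/sqx_gt0.
rewrite -[powR (ug g z) (b - 1)]mulr1 /Ie.
by do 3 (apply: cvgM; first exact: cvg_cst); exact: ppow3_cutoff_cvg.
Qed.

Lemma iint_I_cvg : iint (EFin \o Ie (@harmonic R q)) @[q --> \oo] --> iint If.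
Proof.
apply: iint_cvg => [q|q z|z|z z0].
- by have [] := cut_ucs (harmonic_gt0 q).
- exact: Ie_ge0.
- exact: Ie_nd.
- have u0 : 0 < ug g z by exact/ug_gt0/sqx_gt0.
  have -> : If z = (phi z * phi z * (wx g z * powR (ug g z) (b - 1)))%:E.
    rewrite /If; case: asboolP => [_|/nsupp_ball nz]; first by rewrite weightE.
    by rewrite (phi_nsupp nz) !mul0r.
  by apply: cvg_EFin; [apply: nearW => q|exact: Ie_cvg].
Qed.

Lemma ln_ratio z : 0 < ug g z -> ln (r / rho z) = lnw lr (ug g z) / a.
Proof.
move=> u0; have p0 : 0 < rho z by rewrite /rho gaugeE// powR_gt0.
rewrite ln_div ?posrE// /rho gaugeE// ln_powR /lnw /lr -/a; field.
by rewrite gt_eqF.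
Qed.

(** The factor a^2 compensates [lnw] = a ln (r / rho); the added 0 matches the form handled by
    [ucs_lin] and [Iint_lin]. *)
Lemma iint_J_cvg :
  iint (EFin \o (fun z => a ^+ 2 * Je (@harmonic R q) z + 0)) @[q --> \oo] --> iint Jf.
Proof.
apply: iint_cvg => [q|q z|z|z z0].
- by have [_ uJ _] := cut_ucs (harmonic_gt0 q); exact: (ucs_lin _ _ _ _ _ uJ (ucs0 R n)).
- by rewrite addr0 JeE mulr_ge0 ?sqr_ge0// mulr_ge0 ?Ie_ge0// -expr2 sqr_ge0.
- move=> q1 q2 q12; rewrite !addr0 ler_wpM2l ?sqr_ge0// !JeE.
  by rewrite ler_wpM2r ?Ie_nd// -expr2 sqr_ge0.
- have u0 : 0 < ug g z by exact/ug_gt0/sqx_gt0.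
  have -> : Jf z = (a ^+ 2 * (phi z * phi z * (wx g z * powR (ug g z) (b - 1)) *
      ((lnw lr (ug g z))^-1 * (lnw lr (ug g z))^-1)))%:E.
    rewrite /Jf; case: asboolP => [Bz|/nsupp_ball nz]; last first.
      by rewrite (phi_nsupp nz) !mul0r mulr0.
    have u1 : ug g z < R0 by rewrite -gauge_lt.
    rewrite weightE// ln_ratio//; congr (_%:E); field.
    by rewrite !gt_eqF// lnw_gt0.
  apply: cvg_EFin; first by apply: nearW => q.
  rewrite /comp /=; under eq_fun do rewrite addr0 JeE.
  apply: cvgM; first exact: cvg_cst.
  by apply: cvgM; [exact: Ie_cvg|exact: cvg_cst].
Qed.

Lemma weighted_hardy_rellich :
  ((N ^+ 2 * (Q - al) ^+ 2 / 16)%:E * iint If + (N * (Q - al) / 8)%:E * iint Jf <= iint L)%E.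
Proof.
have [K [d d0 HK]] := Iint_error_le.
have C_ge0 : 0 <= c0 * C.
  apply: mulr_ge0 (ltW c00) (addr_ge0 _ _).
    exact: mulr_ge0 (mulr_ge0 (ler0n R 3) (ltW a0)) (normr_ge0 _).
  exact: mulr_ge0 (ler0n R 6) (sqr_ge0 a).
pose X q := ((c0 ^+ 2)%:E * iint (EFin \o Ie (@harmonic R q)) +
  (c0 / 2)%:E * iint (EFin \o (fun z => a ^+ 2 * Je (@harmonic R q) z + 0)%R))%E.
have I0 : (0 <= iint If)%E.
  apply: iint_ge0 => z; rewrite /If; case: ifP => // _.
  exact: (mulr_ge0 (mulr_ge0 (powR_ge0 _ _) (sqr_ge0 _)) (sqr_ge0 _)).
have J0 : (0 <= iint Jf)%E.
  apply: iint_ge0 => z; rewrite /Jf; case: ifP => // _.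
  rewrite lee_fin; apply: divr_ge0 (sqr_ge0 _).
  exact: (mulr_ge0 (mulr_ge0 (powR_ge0 _ _) (sqr_ge0 _)) (sqr_ge0 _)).
have cX : X q @[q --> \oo] --> ((c0 ^+ 2)%:E * iint If + (c0 / 2)%:E * iint Jf)%E.
  apply: cvgeD.
  - apply: ge0_adde_def; rewrite inE mule_ge0// lee_fin ?sqr_ge0//.
    by rewrite divr_ge0 ?(ltW c00).
  - by apply: cvgeZl => //; exact: iint_I_cvg.
  - by apply: cvgeZl => //; exact: iint_J_cvg.
have -> : N ^+ 2 * (Q - al) ^+ 2 / 16 = c0 ^+ 2 by rewrite /c0; field.
have -> : N * (Q - al) / 8 = c0 / 2 by rewrite /c0; field.
(* The left side is the limit of X q, and X q is at most the integral of L plus an error that is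
   eventually below eps. *)
apply/lee_addgt0Pr => eps eps0.
rewrite -(cvg_lim _ cX)//; apply: lime_le; first by apply/cvg_ex; eexists; exact: cX.
have cpow : powR (@harmonic R q) d @[q --> \oo] --> (0 : R).
  (* [ppow] agrees with [powR] at positive arguments and is already known to be continuous at 0. *)
  have p0 : ppow d x @[x --> (0 : R)] --> (0 : R).
    by rewrite -[X in _ --> X](ppow_le0 d (lexx 0)); exact: ppow_continuous.
  rewrite (_ : (fun q => _) = (fun q => ppow d (@harmonic R q))); last first.
    by apply/funext => q; rewrite ppow_gt0// harmonic_gt0.
  exact: (cvg_comp _ _ (@cvg_harmonic R) p0).
have cerr : c0 * C * (K * powR (@harmonic R q) d) @[q --> \oo] --> (0 : R).
  have E0 : c0 * C * (K * 0) = 0 by rewrite !mulr0.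
  rewrite -[X in _ --> X]E0.
  by do 2 (apply: cvgM; first exact: cvg_cst).
near=> q.
have [uI uJ uE] := cut_ucs (harmonic_gt0 q).
have XE : X q = (c0 ^+ 2 * Iint (Ie (@harmonic R q)) +
    c0 * a ^+ 2 / 2 * Iint (Je (@harmonic R q)))%:E.
  rewrite /X !iintE//; last exact: (ucs_lin _ _ _ _ _ uJ (ucs0 R n)).
  rewrite (@Iint_lin R n _ _ _ uJ (ucs0 R n)) Iint0 addr0 -!EFinM -EFinD; congr (_%:E).
  by field.
have := cut_ineq (harmonic_gt0 q); rewrite EFinB leeBlDr// -XE => /le_trans; apply.
apply: leeD => //; rewrite lee_fin.
apply: (@le_trans _ _ (c0 * C * (K * powR (@harmonic R q) d))).
  by rewrite ler_wpM2l// HK// harmonic_gt0.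
near: q; exact: (cvgr_le _ cerr).
Unshelve. all: by end_near. Qed.

End hardy_rellich.
Unset Implicit Arguments.
Set Strict Implicit.

Theorem theorem4p3 (R : realType) (m k : nat) (g alpha r : R)
  (hm : (0 < m)%N) (hk : (0 < k)%N) (hg : 0 < g)
  (ha1 : 4 - homdim m k g < alpha) (ha2 : alpha < homdim m k g)
  (hr : 0 < r) (phi : 'rV[R]_(m + k) -> R)
  (hphi : Cc_infty (ball_BG m k g r) phi) :
  let Q := homdim m k g in
  let rho := gauge m k g in
  let ngr := fun z => enorm (grad_BG m k g rho z) in
  let B := ball_BG m k g r in
  (((Q + alpha - 4) ^+ 2 * (Q - alpha) ^+ 2 / 16)%:E *
      iint (fun z => if `[< B z >] then
              (powR (rho z) (alpha - 4) * ngr z ^+ 2 * phi z ^+ 2)%:E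
            else 0%E)
   + ((Q + alpha - 4) * (Q - alpha) / 8)%:E *
      iint (fun z => if `[< B z >] then
              (powR (rho z) (alpha - 4) * ngr z ^+ 2 * phi z ^+ 2
                 / (ln (r / rho z)) ^+ 2)%:E
            else 0%E)
   <= iint (fun z => if `[< B z >] then
              ((powR (rho z) alpha * Delta_BG m k g phi z ^+ 2)%:E
                 * ((ngr z ^+ 2)%:E)^-1)%E
            else 0%E))%E.
Proof. exact: (weighted_hardy_rellich hm hg ha1 ha2 hr hphi). Qed.
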